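(* Let $d\ge 1$, let $T>0$, let $\Omega\subset\mathbb{R}^d$ be a bounded open domain, and let $\mathbf{A}:\mathbb{R}^d\times[0,T]\to\mathbb{R}^d$ be continuous with continuous first-order partial derivatives and with $\sup_{\mathbf{x}\in\mathbb{R}^d,\,t\in[0,T]}\|\nabla_{\mathbf{x}}\mathbf{A}(\mathbf{x},t)\|_{\mathrm{op}}\le L_A$ for some constant $L_A>0$. Let $M_A>0$ be a constant with $|\nabla_{\mathbf{x}}\cdot\mathbf{A}(\mathbf{x},t)|\le M_A$ for all $(\mathbf{x},t)\in\mathbb{R}^d\times[0,T]$. Let $\widetilde{\Omega}(t)=\operatorname{D}^{\mathbf{A}}_{T\to t}(\Omega)$ for $t\in[0,T]$, and let $\widetilde{U}_0,\widetilde{V}_0\in H_0(\widetilde{\Omega}(0))$ with $\widetilde{U}_0\ne\widetilde{V}_0$. Then the solutions $U(\mathbf{x},t)$ and $V(\mathbf{x},t)$ of the integral invariant model with initial data $\widetilde{U}_0$ and $\widetilde{V}_0$, respectively, satisfy $$\|U(\cdot,t)-V(\cdot,t)\|_{L^2(\widetilde{\Omega}(t))}\le e^{M_AT/2}\,\|\widetilde{U}_0-\widetilde{V}_0\|_{L^2(\widetilde{\Omega}(0))},\qquad \forall t\in[0,T].$$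
   Context: All functions are real-valued. $\nabla_{\mathbf{x}}\mathbf{A}$ is the spatial Jacobian matrix and $\|\cdot\|_{\mathrm{op}}$ is the operator norm induced by the Euclidean norm. (A uniform gradient bound $L_A$ implies the divergence bound, e.g. with $M_A=dL_A$.) Flow map. Under the stated assumptions on $\mathbf{A}$, for all $t_1,t_2\in[0,T]$ the map $\operatorname{D}^{\mathbf{A}}_{t_1\to t_2}:\mathbb{R}^d\to\mathbb{R}^d$ is defined by $\operatorname{D}^{\mathbf{A}}_{t_1\to t_2}(\mathbf{x})=\mathbf{s}(t_2)=\mathbf{x}+\int_{t_1}^{t_2}\mathbf{A}(\mathbf{s}(\tau),\tau)\,\mathrm{d}\tau$, where $\mathbf{s}$ is the solution on $[0,T]$ of $\frac{\mathrm{d}\mathbf{s}}{\mathrm{d}\tau}=\mathbf{A}(\mathbf{s},\tau)$ with $\mathbf{s}(t_1)=\mathbf{x}$. It is invertible with inverse $\operatorname{D}^{\mathbf{A}}_{t_2\to t_1}$. Function spaces. $H(G)$ denotes $L^2(G)$ with the $L^2$-inner product. For a bounded domain $G$, $H_0(G)=\{f\in L^2(\mathbb{R}^d):\operatorname{supp} f\subset\subset G\}$ (the support is a compact subset of $G$). $L^1([0,T],H(\widetilde{\Omega}(t)))$ is the set of $U$ such that $U(\cdot,t)\in L^2(\widetilde{\Omega}(t))$ for every $t\in[0,T]$ and the map $t\mapsto\|U(\cdot,t)\|_{L^2(\widetilde{\Omega}(t))}$ belongs to $L^1([0,T])$. Test functions. For $\Psi\in H_0(\Omega)$ and $t\in[0,T]$,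 $\psi(\mathbf{x},t)=\operatorname{\Phi}^{\mathbf{A}}_{T\to t}[\Psi](\mathbf{x}):=\Psi(\operatorname{D}^{\mathbf{A}}_{t\to T}(\mathbf{x}))$ for $\mathbf{x}\in\widetilde{\Omega}(t)$. Solution of the integral invariant model. Given $\widetilde{U}_0\in L^2(\widetilde{\Omega}(0))$ (extended by zero to $\mathbb{R}^d$), a function $U\in L^1([0,T],H(\widetilde{\Omega}(t)))$ is a solution of the integral invariant model with initial data $\widetilde{U}_0$ if $U(\cdot,0)=\widetilde{U}_0$ in $\widetilde{\Omega}(0)$ and, for every $\Psi\in H_0(\Omega)$, with $\psi(\mathbf{x},t)=\Psi(\operatorname{D}^{\mathbf{A}}_{t\to T}(\mathbf{x}))$ for $\mathbf{x}\in\widetilde{\Omega}(t)$, $t\in[0,T]$, one has $\frac{\mathrm{d}}{\mathrm{d}t}\int_{\widetilde{\Omega}(t)}U(\mathbf{x},t)\psi(\mathbf{x},t)\,\mathrm{d}\mathbf{x}=0$ on $[0,T]$; equivalently, $\int_{\widetilde{\Omega}(t)}U(\mathbf{x},t)\psi(\mathbf{x},t)\,\mathrm{d}\mathbf{x}=\int_{\widetilde{\Omega}(0)}\widetilde{U}_0(\mathbf{x})\psi(\mathbf{x},0)\,\mathrm{d}\mathbf{x}$ for all $t\in[0,T]$. Equality of $L^2$ functions is almost-everywhere equality. *)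

(* Defs.v *)
From HB Require Import structures.
From mathcomp Require Import all_boot all_order all_algebra.
From mathcomp Require Import all_classical all_reals all_analysis.

Set Implicit Arguments.
Unset Strict Implicit.
Unset Printing Implicit Defensive.

Import Order.TTheory GRing.Theory Num.Theory.
Import numFieldNormedType.Exports.

Local Open Scope classical_set_scope.
Local Open Scope ring_scope.

Definition measure_rV_display : measure_display.
Proof. exact: measure_tuple_display default_measure_display. Qed.

(* The product sigma-algebra, as the library has it for [d.-tuple R]; it is
   the Borel sigma-algebra of ['rV[R]_d]. *)
Section measurable_rV.
Context {R : realType} {d : nat}.

Let coors : 'I_d -> 'rV[R]_d -> measurableTypeR R := fun i v => v ord0 i.

Let rV_set0 : g_sigma_preimage coors set0.
Proof. exact: sigma_algebra0. Qed.

Let rV_setC A : g_sigma_preimage coors A -> g_sigma_preimage coors (~` A).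
Proof. exact: sigma_algebraC. Qed.

Let rV_bigcup (F : _^nat) : (forall i, g_sigma_preimage coors (F i)) ->
  g_sigma_preimage coors (\bigcup_i (F i)).
Proof. exact: sigma_algebra_bigcup. Qed.

HB.instance Definition _ := @isMeasurable.Build measure_rV_display
  'rV[R]_d (g_sigma_preimage coors) rV_set0 rV_setC rV_bigcup.

End measurable_rV.

Lemma measurable_rV_coord (R : realType) d (i : 'I_d) :
  measurable_fun [set: 'rV[R]_d]
    ((fun v => v ord0 i) : 'rV[R]_d -> measurableTypeR R).
Proof.
move=> _ Y mY; rewrite setTI; apply: sub_sigma_algebra => /=.
rewrite -bigcup_seq/=; exists i => /=; first by rewrite mem_index_enum.
by exists Y => //; rewrite setTI.
Qed.

Lemma measurable_fun_rVP (R : realType) d' (T : measurableType d') d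
    (f : T -> 'rV[R]_d) :
  (forall i, measurable_fun [set: T]
    ((fun x => f x ord0 i) : T -> measurableTypeR R)) ->
  measurable_fun [set: T] f.
Proof.
move=> mf; pose coors (i : 'I_d) (v : 'rV[R]_d) : measurableTypeR R := v ord0 i.
move=> _ Y mY; rewrite setTI.
have : preimage_set_system setT f (g_sigma_preimage coors) (f @^-1` Y).
  by exists Y => //; rewrite setTI.
rewrite -g_sigma_preimage_comp.
apply: smallest_sub; first exact: sigma_algebra_measurable.
case: d => [|n] in f coors mf Y mY *; first by rewrite big_ord0.
rewrite -bigcup_mkord_ord; apply: bigcup_sub => i Ii.
by move=> A [B mB <-]; exact: mf.
Qed.

Definition rV_cons (R : realType) d (p : measurableTypeR R * 'rV[R]_d) :
  'rV[R]_d.+1 := \row_i (if unlift ord0 i is Some j then p.2 ord0 j else p.1).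

Definition rV_uncons (R : realType) d (v : 'rV[R]_d.+1) :
  measurableTypeR R * 'rV[R]_d := (v ord0 ord0, \row_j v ord0 (lift ord0 j)).

Lemma rV_consK (R : realType) d : cancel (@rV_cons R d) (@rV_uncons R d).
Proof.
move=> [x v]; rewrite /rV_uncons mxE unlift_none /=; congr pair.
by apply/rowP => j; rewrite !mxE liftK.
Qed.

Lemma rV_unconsK (R : realType) d : cancel (@rV_uncons R d) (@rV_cons R d).
Proof.
move=> v; apply/rowP => i; rewrite !mxE.
by case: unliftP => [j ->|->] //=; rewrite mxE.
Qed.

Lemma measurable_rV_cons (R : realType) d :
  measurable_fun [set: measurableTypeR R * 'rV[R]_d] (@rV_cons R d).
Proof.
apply: measurable_fun_rVP => i.
rewrite (_ : (fun p => _) = (fun p : measurableTypeR R * 'rV[R]_d =>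
    if unlift ord0 i is Some j then p.2 ord0 j else p.1)); last first.
  by apply/funext => p; rewrite mxE.
case: unliftP => [j _|_]; last exact: measurable_fst.
apply: (measurableT_comp (measurable_rV_coord j)); exact: measurable_snd.
Qed.

Lemma measurable_rV_uncons (R : realType) d :
  measurable_fun [set: 'rV[R]_d.+1] (@rV_uncons R d).
Proof.
apply/measurable_fun_pairP; split; first exact: measurable_rV_coord.
apply: measurable_fun_rVP => i /=.
rewrite (_ : (fun p => _) = (fun p : 'rV[R]_d.+1 => p ord0 (lift ord0 i))).
  exact: measurable_rV_coord.
by apply/funext => p /=; rewrite mxE.
Qed.

Section lebesgue_rV_rec.
Context {R : realType} {d : nat}
  (mu : {sigma_finite_measure set 'rV[R]_d -> \bar R}).

Definition lebesgue_rV_succ : set 'rV[R]_d.+1 -> \bar R :=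
  pushforward (@lebesgue_measure R \x mu)%E (@rV_cons R d).

HB.instance Definition _ := Measure.copy lebesgue_rV_succ
  (measure_function_pushforward__canonical__measure_function_Measure
     (@lebesgue_measure R \x mu)%E (@measurable_rV_cons R d)).

Let sigma_finite_lebesgue_rV_succ : sigma_finite setT lebesgue_rV_succ.
Proof.
have [F FT Fmu] := sigma_finiteT (@lebesgue_measure R).
have [G GT Gmu] := sigma_finiteT mu.
exists (fun k => if unpickle k is Some ij then
  @rV_uncons R d @^-1` (F ij.1 `*` G ij.2) else set0).
  rewrite eqEsubset; split=> // v _.
  have : [set: measurableTypeR R] (rV_uncons v).1 by [].
  rewrite FT => -[i _ Fi].
  have : [set: 'rV[R]_d] (rV_uncons v).2 by [].
  rewrite GT => -[j _ Gj].
  by exists (pickle (i, j)) => //; rewrite pickleK.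
move=> k; case: unpickle => [[i j]|]; last first.
  by split; [exact: measurable0|rewrite measure0].
have [mF Foo] := Fmu i; have [mG Goo] := Gmu j.
split.
  rewrite -[_ @^-1` _]setTI; apply: measurable_rV_uncons => //.
  exact: measurableX.
rewrite /lebesgue_rV_succ /pushforward -comp_preimage.
rewrite (_ : _ \o _ = idfun) ?preimage_id; last first.
  by apply/funext => p /=; rewrite rV_consK.
rewrite product_measure1E//=.
by rewrite lte_mul_pinfty// ge0_fin_numE.
Qed.

HB.instance Definition _ := @Measure_isSigmaFinite.Build _ _ _
  lebesgue_rV_succ sigma_finite_lebesgue_rV_succ.

End lebesgue_rV_rec.

Section lebesgue_rV0.
Context {R : realType}.

Definition lebesgue_rV_zero : set 'rV[R]_0 -> \bar R := \d_(0 : 'rV[R]_0).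

HB.instance Definition _ := Measure.on lebesgue_rV_zero.

Let finite_lebesgue_rV_zero : fin_num_fun lebesgue_rV_zero.
Proof. by move=> A mA; rewrite /lebesgue_rV_zero diracE. Qed.

HB.instance Definition _ := @Measure_isFinite.Build _ _ _
  lebesgue_rV_zero finite_lebesgue_rV_zero.

End lebesgue_rV0.

(* The d-fold product of the Lebesgue measure of the line. *)
Fixpoint lebesgue_rV (R : realType) d :
    {sigma_finite_measure set 'rV[R]_d -> \bar R} :=
  if d is d'.+1 then lebesgue_rV_succ (lebesgue_rV R d') else lebesgue_rV_zero.

Definition enorm (R : realType) d (v : 'rV[R]_d) : R :=
  Num.sqrt (\sum_(i < d) v ord0 i ^+ 2).

(* Row-vector convention: [M] stands for the linear map [v |-> v *m M]. *)
Definition opnorm (R : realType) m n (M : 'M[R]_(m, n)) : R :=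
  sup [set enorm (v *m M) | v in [set v | enorm v <= 1]].

(* ['J f x] is the transpose of the usual Jacobian matrix:
   ['D_v f x = v *m 'J f x]. *)
Definition spatial_jacobian (R : realType) d (A : 'rV[R]_d -> R -> 'rV[R]_d)
  (x : 'rV[R]_d) (t : R) : 'M[R]_d := 'J (A ^~ t) x.

Definition divergence (R : realType) d (A : 'rV[R]_d -> R -> 'rV[R]_d)
  (x : 'rV[R]_d) (t : R) : R := \tr (spatial_jacobian A x t).

(* One-sided at the endpoints when [I] is a segment. *)
Definition is_derive_within (R : realType) (V : normedModType R) (I : set R)
    (f : R -> V) (t : R) (l : V) : Prop :=
  (u - t)^-1 *: (f u - f t) @[u --> within I t^'] --> l.

(* [A] is C^1 on R^d x [0, T]; only the values of [A] there matter. *)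
Definition C1_field (R : realType) d (T : R) (A : 'rV[R]_d -> R -> 'rV[R]_d) :=
  let D := [set: 'rV[R]_d] `*` [set` `[0, T]] in
  [/\ {within D, continuous (fun p => A p.1 p.2)},
      forall j : 'I_d,
        (forall x t, t \in `[0, T] -> derivable (A ^~ t) x (delta_mx ord0 j)) /\
        {within D, continuous
          (fun p => 'D_(delta_mx ord0 j) (A ^~ p.2) p.1)} &
      exists2 dtA : 'rV[R]_d -> R -> 'rV[R]_d,
        (forall x t, t \in `[0, T] ->
          is_derive_within [set` `[0, T]] (A x) t (dtA x t)) &
        {within D, continuous (fun p => dtA p.1 p.2)}].

Definition ode_solution (R : realType) d (A : 'rV[R]_d -> R -> 'rV[R]_d)
    (T t1 : R) (x : 'rV[R]_d) (s : R -> 'rV[R]_d) : Prop :=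
  s t1 = x /\
  forall t, t \in `[0, T] ->
    is_derive_within [set` `[0, T]] s t (A (s t) t).

(* Meaningful for [t1] and [t2] in [0, T], where the solution exists and is
   unique for the fields considered here. *)
Definition flow (R : realType) d (A : 'rV[R]_d -> R -> 'rV[R]_d)
    (T t1 t2 : R) (x : 'rV[R]_d) : 'rV[R]_d :=
  xget (fun=> 0) (ode_solution A T t1 x) t2.

Definition moving_domain (R : realType) d (A : 'rV[R]_d -> R -> 'rV[R]_d)
    (T : R) (Omega : set 'rV[R]_d) (t : R) : set 'rV[R]_d :=
  flow A T T t @` Omega.

Definition L2norm (R : realType) d (G : set 'rV[R]_d) (f : 'rV[R]_d -> R) :
  \bar R := 'N[lebesgue_rV R d]_2%:E [EFin \o (f \_ G)].

(* Elements of L^2 are represented by Borel functions. *)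
Definition in_L2 (R : realType) d (G : set 'rV[R]_d) (f : 'rV[R]_d -> R) :=
  measurable_fun G f /\ (L2norm G f < +oo)%E.

(* The support of the class of [f] modulo almost everywhere equality. *)
Definition ess_supp (R : realType) d (f : 'rV[R]_d -> R) : set 'rV[R]_d :=
  ~` \bigcup_(O in [set O : set 'rV[R]_d |
       open O /\ (f = cst 0 %[ae lebesgue_rV R d in O])]) O.

Definition H0 (R : realType) d (G : set 'rV[R]_d) (f : 'rV[R]_d -> R) :=
  [/\ in_L2 [set: 'rV[R]_d] f, compact (ess_supp f) & ess_supp f `<=` G].

Definition in_L1H (R : realType) d (T : R) (G : R -> set 'rV[R]_d)
    (U : 'rV[R]_d -> R -> R) :=
  (forall t, t \in `[0, T] -> in_L2 (G t) (U ^~ t)) /\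
  (@lebesgue_measure R).-integrable [set` `[0, T]]
    (fun t => L2norm (G t) (U ^~ t)).

Definition test_function (R : realType) d (A : 'rV[R]_d -> R -> 'rV[R]_d)
    (T : R) (Psi : 'rV[R]_d -> R) (x : 'rV[R]_d) (t : R) : R :=
  Psi (flow A T t T x).

Definition integral_invariant_solution (R : realType) d
    (A : 'rV[R]_d -> R -> 'rV[R]_d) (T : R) (Omega : set 'rV[R]_d)
    (U0 : 'rV[R]_d -> R) (U : 'rV[R]_d -> R -> R) :=
  let Omt := moving_domain A T Omega in
  [/\ in_L1H T Omt U,
      U ^~ 0 = U0 %[ae lebesgue_rV R d in Omt 0] &
      forall Psi, H0 Omega Psi -> forall t, t \in `[0, T] ->
        is_derive_within [set` `[0, T]]
          (fun t => \int[lebesgue_rV R d]_(x in Omt t)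
                      (U x t * test_function A T Psi x t) : R^o) t 0].

(* Main.v *)
(* The bound on the divergence makes the flow distort volume by at most a factor
   e^{M_A t}, in the weak form: the integral of f o D_{0 -> t} is at most
   e^{M_A t} times that of f, for f >= 0 Borel.  This is obtained without a
   change of variables formula in dimension d: over a short time the flow is
   approximated by a composition of d shears, each moving one coordinate, for
   which the one-dimensional substitution rule and Tonelli are enough; the
   errors are o(h) per step for Lipschitz f, and outer regularity of the measure
   extends the bound to Borel f.

   With w = U(., t) - V(., t) and w0 = U0 - V0, conservation of the integrals
   against g o D_{T -> t} gives that the integral of w g equals the one of
   w0 (g o D_{0 -> t}).  Taking for g the truncations of w to preimages of
   compact subsets of Omega and letting them tend to w, Young's inequality and
   the volume bound yield ||w||^2 <= e^{M_A t} ||w0||^2. *)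
Require Import Defs.
From mathcomp Require Import all_boot all_order all_algebra.
From mathcomp Require Import all_classical all_reals all_analysis.
From mathcomp Require Import measurable_realfun ring lra.

Set Implicit Arguments.
Unset Strict Implicit.
Unset Printing Implicit Defensive.

Import Order.TTheory GRing.Theory Num.Theory.
Import numFieldNormedType.Exports.

Local Open Scope classical_set_scope.
Local Open Scope ring_scope.

(** * Differential inequalities *)

(** The spatial derivative of the flow and Liouville's formula never appear: of each D_{a -> b} only
    a Lipschitz constant and a growth bound in x are used. Shears bring in the divergence directly,
    since the shear of coordinate i has Jacobian 1 + h d_i A_i and the product of these factors is
    about exp(h div A). A lower bound of that product is what bounds the integral of f o D_{0 -> t}
    from above.

    The errors o(h) can be summed because f o D_{s -> b} has a Lipschitz constant and a support
    radius independent of s: one step size serves the whole interval, and the total error is a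
    multiple of an arbitrary e.

    In the duality argument the weights of Young's inequality are c/2 and 1/(2c) with c = e^{M_A t};
    the volume bound turns the second term into half of the square integral being estimated. That
    half can be subtracted only from a finite quantity, and test functions must live on a compact
    subset of Omega; the truncations provide both.

    Row vectors carry the sup norm whereas the gradient bound is Euclidean. The mismatch only
    enlarges the Lipschitz constant to d L_A, which has disappeared from the final bound. *)

Lemma mx_norm_coord (R : realType) d (v : 'rV[R]_d) i : `|v ord0 i| <= `|v|.
Proof.
rewrite [leRHS]/Num.Def.normr /= mx_normrE.
by apply: (le_bigmax _ (fun ij : 'I_1 * 'I_d => `|v ij.1 ij.2|) (ord0, i)).
Qed.

Lemma mx_norm_le (R : realType) d (v : 'rV[R]_d) r : 0 <= r ->
  (forall i, `|v ord0 i| <= r) -> `|v| <= r.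
Proof.
move=> r0 H; rewrite [leLHS]/Num.Def.normr /= mx_normrE; apply/bigmax_leP; split=> //.
by move=> [i j] _ /=; rewrite (ord1 i).
Qed.

(** The bound on [df] gives both [g - f] and [g + f] a nonnegative derivative; the mean value
    theorem for each yields one half of the two-sided estimate. *)
Lemma le_increments (R : realType) (f g df dg : R -> R) (a b : R) : a <= b ->
  (forall t, t \in `]a, b[ -> is_derive t 1 f (df t)) ->
  (forall t, t \in `]a, b[ -> is_derive t 1 g (dg t)) ->
  {within `[a, b], continuous f} -> {within `[a, b], continuous g} ->
  (forall t, t \in `]a, b[ -> `|df t| <= dg t) ->
  `|f b - f a| <= g b - g a.
Proof.
rewrite le_eqVlt => /predU1P[<-|ab]; first by rewrite !subrr normr0.
move=> hf hg cf cg H.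
have [| |c cab E1] := @MVT _ (g \- f) (dg \- df) a b ab.
- by move=> t tab; apply: is_deriveB; [exact: hg|exact: hf].
- by move=> t; apply: cvgB; [exact: cg|exact: cf].
have [| |c' cab' E2] := @MVT _ (g \+ f) (dg \+ df) a b ab.
- by move=> t tab; apply: is_deriveD; [exact: hg|exact: hf].
- by move=> t; apply: cvgD; [exact: cg|exact: cf].
move: (H _ cab) (H _ cab'); rewrite !ler_norml => /andP[h1 h2] /andP[h3 h4].
have : 0 <= (dg \- df) c * (b - a) by rewrite mulr_ge0 ?subr_ge0 ?(ltW ab).
have : 0 <= (dg \+ df) c' * (b - a).
  rewrite mulr_ge0 ?subr_ge0 ?(ltW ab)//= -lerBlDr sub0r; lra.
by rewrite -E1 -E2 /= => *; apply/andP; split; lra.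
Qed.

Lemma is_derive_within_continuous (R : realType) (V : normedModType R) (I : set R)
    (f : R -> V) (t : R) (l : V) :
  is_derive_within I f t l -> f u @[u --> within I (nbhs t)] --> f t.
Proof.
move=> H; have H1 : f u @[u --> within I t^'] --> f t.
  have -> : f t = f t + (0 : R) *: l by rewrite scale0r addr0.
  have : (f t + (u - t) *: ((u - t)^-1 *: (f u - f t))) @[u --> within I t^'] -->
      f t + (0 : R) *: l.
    apply: cvgD; first exact: cvg_cst.
    apply: cvgZ => //; rewrite -(subrr t); apply: cvgB; last exact: cvg_cst.
    by move=> A At; rewrite /within /dnbhs /within /=; apply: filterS At.
  apply: cvg_trans; apply: near_eq_cvg; rewrite near_withinE.
  near=> u => _; rewrite scalerA mulfV ?scale1r ?subrKC//.
  by rewrite subr_eq0; near: u; exact: nbhs_dnbhs_neq.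
move=> A /[dup] /nbhs_singleton Aft /H1; rewrite /nbhs /= !nbhs_simpl /within /=.
rewrite /dnbhs /within /= => H2; near=> u => Iu.
have [->//|ut] := eqVneq u t.
by move: ut Iu; near: u.
Unshelve. all: by end_near. Qed.

Lemma is_derive_within_interior (R : realType) (V : normedModType R) (a b : R)
    (f : R -> V) (t : R) (l : V) : t \in `]a, b[ ->
  is_derive_within [set` `[a, b]] f t l -> is_derive t 1 f l.
Proof.
move=> tab H; have H1 : (h^-1 *: ((f \o shift t) (h *: 1) - f t)) @[h --> 0^'] --> l.
  have : ((u - t)^-1 *: (f u - f t)) @[u --> (h + t) @[h --> 0^']] --> l.
    apply: cvg_trans H; apply: cvg_app => A.
    move=> At; have {}At : \forall u \near t, u != t -> u \in `[a, b] -> A u by exact: At.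
    have ht : (h + t) @[h --> (0 : R)] --> t.
      by rewrite -[X in _ --> X]add0r; apply: cvgD; [exact: cvg_id|exact: cvg_cst].
    have It : \forall u \near t, u \in `]a, b[ by exact: near_in_itvoo.
    suff : \forall h \near (0 : R), h != 0 -> A (h + t) by [].
    near=> h => h0; have hab : h + t \in `[a, b].
      apply: subset_itv_oo_cc; near: h; exact: (ht _ It).
    have : h + t != t by rewrite -subr_eq0 addrK.
    by move: hab => /[swap]; near: h; exact: (ht _ At).
  apply: cvg_trans; apply: near_eq_cvg; near=> h.
  by rewrite /= addrK [h *: 1]mulr1.
by apply: DeriveDef; [apply/cvg_ex; exists l | exact/cvg_lim].
Unshelve. all: by end_near. Qed.

Lemma is_derive_within_coord (R : realType) d (I : set R)
    (s : R -> 'rV[R]_d) (t : R) (l : 'rV[R]_d) i :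
  is_derive_within I s t l ->
  is_derive_within I (fun u => s u ord0 i) t (l ord0 i).
Proof.
move=> /(continuous_cvg _ (@coord_continuous R 1 d ord0 i l)).
by apply: cvg_trans; apply: near_eq_cvg; near=> u; rewrite /= !mxE.
Unshelve. all: by end_near. Qed.

Lemma is_derive_within_segment (R : realType) (V : normedModType R) (a b : R)
    (f df : R -> V) :
  (forall t, t \in `[a, b] -> is_derive_within [set` `[a, b]] f t (df t)) ->
  {within `[a, b], continuous f}.
Proof.
move=> H; apply/subspace_continuousP => t /= tab.
exact: is_derive_within_continuous (H t tab).
Qed.

(** Integrating from [t1] reproduces the exponential divided by [k]; the exact term [- B / k] is
    dropped. The gain of [1 / k] makes weighted estimates contractive on all of [0, T], and [B = 0]
    says that a function with zero derivative is constant. *)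
Lemma exp_growth (R : realType) (T t1 k B : R) (f df : R -> R) :
  0 < k -> t1 \in `[0, T] ->
  (forall t, t \in `[0, T] -> is_derive_within [set` `[0, T]] f t (df t)) ->
  (forall t, t \in `[0, T] -> `|df t| <= B * expR (k * `|t - t1|)) ->
  forall t, t \in `[0, T] -> `|f t - f t1| <= B / k * expR (k * `|t - t1|).
Proof.
move=> k0 t1T Hf HB t tT.
have B0 : 0 <= B.
  have := HB _ t1T; rewrite subrr normr0 mulr0 expR0 mulr1; exact: le_trans.
have cf := is_derive_within_segment Hf.
(* [c = 1] serves to the right of [t1] and [c = -1] to the left: as [c ^+ 2 = 1], the derivative of
   [G c] is B exp(k|u - t1|) on the corresponding side. *)
pose G (c u : R) := c * (B / k * expR (k * (c * (u - t1)))).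
have dE (c : R) (u : R) : is_derive u 1 (G c)
    (c ^+ 2 * (B * expR (k * (c * (u - t1))))).
  apply: is_derive_eq; rewrite /GRing.scale /=.
  by field; rewrite gt_eqF.
have cvE (c : R) (A : set R) : {within A, continuous (G c)}.
  apply: continuous_subspaceT => u; apply/differentiable_continuous.
  by apply/derivable1_diffP; have [] := dE c u.
have key c a b : 0 <= a -> a <= b -> b <= T -> c ^+ 2 = 1 ->
    (forall u, a <= u <= b -> c * (u - t1) = `|u - t1|) ->
    `|f b - f a| <= G c b - G c a.
  move=> a0 ab bT c1 Hc; have sub : `[a, b] `<=` `[0, T].
    by move=> u /=; rewrite !in_itv/= => /andP[h1 h2]; apply/andP; split; lra.
  apply: (@le_increments _ f (G c) df (fun u => c ^+ 2 * (B * expR (k * (c * (u - t1)))))) => //.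
  - move=> u uab; apply: is_derive_within_interior (Hf u _).
      by move: uab; rewrite !in_itv/= => /andP[h1 h2]; apply/andP; split; lra.
    by apply: sub; apply: subset_itv_oo_cc.
  - by apply: continuous_subspaceW cf.
  - move=> u uab; rewrite c1 mul1r Hc; last by rewrite !ltW ?(itvP uab).
    by apply: HB; apply: sub; apply: subset_itv_oo_cc.
have Bk : 0 <= B / k by rewrite divr_ge0// ltW.
have [le|/ltW le] := leP t1 t.
  apply: le_trans (key 1 t1 t _ le _ _ _) _; rewrite ?(itvP t1T) ?(itvP tT) ?expr1n//.
    by move=> u /andP[u1 _]; rewrite mul1r ger0_norm// subr_ge0.
  rewrite /G !mul1r subrr mulr0 expR0 ger0_norm ?subr_ge0//; lra.
rewrite distrC; apply: le_trans (key (-1) t t1 _ le _ _ _) _; rewrite ?(itvP t1T) ?(itvP tT) ?sqrrN ?expr1n//.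
  by move=> u /andP[_ u1]; rewrite mulN1r ler0_norm// subr_le0.
rewrite /G !mulN1r subrr oppr0 mulr0 expR0 ler0_norm ?subr_le0//; lra.
Qed.

Lemma exp_growth_rV (R : realType) d (T t1 k B : R) (f df : R -> 'rV[R]_d) :
  0 < k -> t1 \in `[0, T] ->
  (forall t, t \in `[0, T] -> is_derive_within [set` `[0, T]] f t (df t)) ->
  (forall t, t \in `[0, T] -> `|df t| <= B * expR (k * `|t - t1|)) ->
  forall t, t \in `[0, T] -> `|f t - f t1| <= B / k * expR (k * `|t - t1|).
Proof.
move=> k0 t1T Hf HB t tT.
have B0 : 0 <= B.
  have := HB _ t1T; rewrite subrr normr0 mulr0 expR0 mulr1; exact: le_trans.
apply: mx_norm_le => [|i]; first by rewrite !mulr_ge0 ?expR_ge0 ?invr_ge0 ?(ltW k0).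
rewrite !mxE; apply: (@exp_growth _ T t1 k B (fun u => f u ord0 i) (fun u => df u ord0 i)) => //.
  by move=> u uT; apply: is_derive_within_coord; exact: Hf.
by move=> u uT; apply: le_trans (HB _ uT); exact: mx_norm_coord.
Qed.

(** * The flow of a Lipschitz field *)

(* Precomposing the time with [clamp T] turns a field known on [0, T] only into
   one that is continuous for all times. *)
Definition clamp (R : realType) (T t : R) : R := Order.max 0 (Order.min t T).

Section clamp.
Context (R : realType) (T : R).

Lemma clamp_id t : t \in `[0, T] -> clamp T t = t.
Proof.
by rewrite in_itv/= => /andP[t0 tT]; rewrite /clamp min_l// max_r.
Qed.

Lemma clamp_in t : 0 <= T -> clamp T t \in `[0, T].
Proof.
move=> T0; rewrite in_itv/= /clamp le_max lexx/= ge_max T0/=.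
by rewrite ge_min lexx orbT.
Qed.

Lemma clamp_continuous : continuous (clamp T).
Proof.
move=> t; apply: (@continuous_max R R (cst 0) (fun u => Order.min u T)).
  exact: cst_continuous.
apply: (@continuous_min R R id (cst T)); first exact: cvg_id.
exact: cst_continuous.
Qed.

Lemma within_clamp_continuous (V : topologicalType) (f : R -> V) : 0 <= T ->
  {within `[0, T], continuous f} -> continuous (f \o clamp T).
Proof.
move=> T0 /subspace_continuousP cf t; have cT := clamp_in t T0.
apply: cvg_comp (cf _ cT) => A /= At.
have {}At : \forall u \near clamp T t, u \in `[0, T] -> A u by exact: At.
suff : \forall u \near t, A (clamp T u) by [].
near=> u; have : clamp T u \in `[0, T] by exact: clamp_in.
by near: u; exact: (clamp_continuous At).
Unshelve. all: by end_near.
Qed.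

End clamp.

Lemma cvg_rV (R : realType) d (S : Type) (F : set_system S) (f : S -> 'rV[R]_d)
    (l : 'rV[R]_d) : Filter F ->
  (forall i, f x ord0 i @[x --> F] --> l ord0 i) -> f @ F --> l.
Proof.
move=> FF H A [P MP sPA].
have : \forall x \near F, forall i, P ord0 i (f x ord0 i).
  by apply: filter_forall => i; exact: H (MP ord0 i).
by apply: filterS => x Px; apply: sPA => i j; rewrite (ord1 i).
Qed.

Lemma is_derive_is_derive_within (R : realType) (V : normedModType R) (I : set R)
    (f : R -> V) (t : R) (l : V) : is_derive t 1 f l -> is_derive_within I f t l.
Proof.
move=> [/[swap] <- /cvg_ex[l' H]].
have -> : 'D_1 f t = l' by exact/cvg_lim.
move=> A At; have {}At : \forall h \near (0:R), h != 0 ->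
  A (h^-1 *: (f (h *: 1 + t) - f t)) by exact: H At.
suff : \forall u \near t, u != t -> I u -> A ((u - t)^-1 *: (f u - f t)) by [].
have ht : (u - t) @[u --> t] --> (0 : R).
  by rewrite -[X in _ --> X](subrr t); apply: cvgB; [exact: cvg_id|exact: cvg_cst].
near=> u => ut _.
rewrite -[X in f X](subrK t) -[X in f (X + t)]mulr1.
have : u - t != 0 by rewrite subr_eq0.
by near: u; exact: (ht _ At).
Unshelve. all: by end_near. Qed.

Lemma primitive_exists (R : realType) (T : R) (f : R -> R) : continuous f ->
  exists P : R -> R, forall t, t \in `[0, T] -> is_derive_within [set` `[0, T]] P t (f t).
Proof.
(* Integrating from -1, inside a segment ending at [T + 1], makes every point of [0, T] interior, so
   the two-sided fundamental theorem also covers the endpoints. *)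
move=> cf; exists (fun x => \int[lebesgue_measure]_(t in [set` `[-1, x]]) (f t))%R.
move=> t /[dup] tT; rewrite in_itv/= => /andP[t0 tT1].
apply: is_derive_is_derive_within.
have tu : t < T + 1 by lra.
have [] := @continuous_FTC1_closed R f (-1) t (T + 1) tu.
- apply: continuous_compact_integrable; first exact: segment_compact.
  exact: continuous_subspaceT.
- lra.
- exact: cf.
by move=> h1 h2; rewrite -h2 derive1E; exact: derivableP.
Qed.

Lemma is_derive_within_rV (R : realType) d (I : set R)
    (s : R -> 'rV[R]_d) (t : R) (l : 'rV[R]_d) :
  (forall i, is_derive_within I (fun u => s u ord0 i) t (l ord0 i)) ->
  is_derive_within I s t l.
Proof.
move=> H; apply: cvg_rV => i; apply: cvg_trans (H i).
by apply: near_eq_cvg; near=> u; rewrite /= !mxE.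
Unshelve. all: by end_near. Qed.

Lemma primitive_exists_rV (R : realType) d (T : R) (f : R -> 'rV[R]_d) : continuous f ->
  exists P : R -> 'rV[R]_d,
    forall t, t \in `[0, T] -> is_derive_within [set` `[0, T]] P t (f t).
Proof.
move=> cf; have /choice[P HP] (i : 'I_d) : exists P : R -> R, forall t, t \in `[0, T] ->
    is_derive_within [set` `[0, T]] P t (f t ord0 i).
  apply: (@primitive_exists R T (fun t => f t ord0 i)) => t.
  exact: (continuous_cvg _ (@coord_continuous R 1 d ord0 i (f t)) (cf t)).
exists (fun t => \row_i P i t) => t tT; apply: is_derive_within_rV => i.
by rewrite (_ : (fun u => _) = P i); [exact: HP|apply/funext => u; rewrite mxE].
Qed.

Lemma geometric_le0 (R : realType) (a C : R) :
  (forall n, a <= C * 2^-1 ^+ n) -> a <= 0.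
Proof.
move=> H; have : C * 2^-1 ^+ n @[n --> \oo] --> (0 : R).
  apply: (@cvg_geometric R C 2^-1); rewrite ger0_norm; lra.
by move=> H0; rewrite -(cvg_lim _ H0)//; apply: limr_ge; [apply/cvg_ex; exists 0|exact: nearW].
Qed.

Lemma is_derive_withinB (R : realType) (V : normedModType R) (I : set R)
    (f g : R -> V) t (l k : V) :
  is_derive_within I f t l -> is_derive_within I g t k ->
  is_derive_within I (fun u => f u - g u) t (l - k).
Proof.
move=> /cvgB H /H{H}; apply: cvg_trans; apply: near_eq_cvg; near=> u.
by rewrite !fctE -scalerBr; congr (_ *: _); rewrite !opprD addrACA.
Unshelve. all: by end_near. Qed.

Section ode.
Context (R : realType) (d : nat) (T K : R) (A : 'rV[R]_d -> R -> 'rV[R]_d).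
Hypotheses (T0 : 0 <= T) (K0 : 0 < K).
Hypothesis Acont : continuous (fun p : 'rV[R]_d * R => A p.1 (clamp T p.2)).
Hypothesis Alip : forall x y t, t \in `[0, T] -> `|A x t - A y t| <= K * `|x - y|.

Let solves (s : R -> 'rV[R]_d) := forall t, t \in `[0, T] ->
  is_derive_within [set` `[0, T]] s t (A (s t) t).

(** Gronwall's inequality through a weighted norm. If m is the maximum of |s1 - s2| exp(-2K|t -
    t1|), integrating the Lipschitz bound gives m <= |s1 t1 - s2 t1| + m / 2, whence the factor 2;
    the exponential comes from removing the weight. *)
Lemma ode_lipschitz t1 s1 s2 : t1 \in `[0, T] -> solves s1 -> solves s2 ->
  forall t, t \in `[0, T] ->
    `|s1 t - s2 t| <= 2 * expR (2 * K * T) * `|s1 t1 - s2 t1|.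
Proof.
move=> t1T h1 h2.
have he t : t \in `[0, T] -> is_derive_within [set` `[0, T]] (fun u => s1 u - s2 u) t
    (A (s1 t) t - A (s2 t) t).
  by move=> tT; apply: is_derive_withinB; [exact: h1|exact: h2].
have ce := is_derive_within_segment he.
pose w t := expR (- (2 * K * `|t - t1|)).
have cw : continuous w.
  move=> t; apply: (@continuous_comp _ _ _ (fun t => - (2 * K * `|t - t1|)) expR);
    last exact: continuous_expR.
  apply: continuousN; apply: cvgM; first exact: cvg_cst.
  by apply: cvg_norm; apply: cvgB; [exact: cvg_id|exact: cvg_cst].
have [|c cT hc] := @EVT_max R (fun t => `|s1 t - s2 t| * w t) 0 T T0.
  move=> t; apply: cvgM; last exact: (continuous_subspaceT cw).
  by apply: cvg_norm; exact: ce.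
set m := `|s1 c - s2 c| * w c in hc.
have m0 : 0 <= m by rewrite mulr_ge0 ?expR_ge0.
have wE t : w t * expR (2 * K * `|t - t1|) = 1.
  by rewrite -expRD addNr expR0.
have hm t : t \in `[0, T] -> `|s1 t - s2 t| <= m * expR (2 * K * `|t - t1|).
  move=> tT; apply: (@le_trans _ _ (`|s1 t - s2 t| * w t * expR (2 * K * `|t - t1|))).
    by rewrite -mulrA wE mulr1.
  by apply: ler_wpM2r; [exact: expR_ge0|exact: hc].
have k0 : 0 < 2 * K by rewrite mulr_gt0.
have key t : t \in `[0, T] ->
    `|s1 t - s2 t| <= `|s1 t1 - s2 t1| + m / 2 * expR (2 * K * `|t - t1|).
  move=> tT.
  have := @exp_growth_rV _ _ T t1 (2 * K) (K * m) _ _ k0 t1T he _ t tT.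
  have -> : K * m / (2 * K) = m / 2 by field; rewrite gt_eqF.
  move=> H; have {}H := H _; rewrite -lerBlDl; apply: le_trans (lerB_dist _ _) _; apply: H.
  move=> u uT; apply: le_trans (Alip _ _ uT) _.
  by rewrite -mulrA ler_wpM2l ?(ltW K0)//; exact: hm.
have hm2 : m <= 2 * `|s1 t1 - s2 t1|.
  have := key c cT; rewrite -(ler_pM2r (_ : 0 < w c)) ?expR_gt0// -/m mulrDl -mulrA.
  have -> : m * (2^-1 * expR (2 * K * `|c - t1|)) * w c =
    m / 2 * (w c * expR (2 * K * `|c - t1|)) by ring.
  rewrite wE mulr1.
  have : `|s1 t1 - s2 t1| * w c <= `|s1 t1 - s2 t1|.
    rewrite ler_piMr// -expR0 ler_expR oppr_le0 mulr_ge0 ?(ltW k0)//.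
  lra.
move=> t tT; apply: le_trans (hm t tT) _.
rewrite [leRHS]mulrAC ler_pM ?expR_ge0// ler_expR ler_wpM2l ?(ltW k0)//.
by move: tT t1T; rewrite !in_itv/= ler_norml => /andP[? ?] /andP[? ?]; apply/andP; split; lra.
Qed.

Let prim (f : R -> 'rV[R]_d) : R -> 'rV[R]_d :=
  xget f [set P | forall t, t \in `[0, T] -> is_derive_within [set` `[0, T]] P t (f t)].

Let primP f : continuous f ->
  forall t, t \in `[0, T] -> is_derive_within [set` `[0, T]] (prim f) t (f t).
Proof.
move=> cf; have [P HP] := primitive_exists_rV T cf.
by apply: (@xgetPex _ f [set P | forall t, t \in `[0, T] -> is_derive_within [set` `[0, T]] P t (f t)]); exists P. Qed.

(** [prim] is controlled on [0, T] only; evaluating it at [clamp T t] makes every iterate continuous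
    on the whole line, so that the next primitive exists. *)
Let picard t1 (x : 'rV[R]_d) (s : R -> 'rV[R]_d) (t : R) : 'rV[R]_d :=
  x + (prim (fun u => A (s u) (clamp T u)) (clamp T t)
    - prim (fun u => A (s u) (clamp T u)) t1).

Let Acomp s : continuous s -> continuous (fun u => A (s u) (clamp T u)).
Proof.
move=> cs u.
apply: (@continuous_comp _ _ _ (fun u => (s u, u)) (fun p : 'rV[R]_d * R => A p.1 (clamp T p.2))).
  exact: (cvg_pair (cs u) cvg_id).
exact: Acont.
Qed.

Let picard_continuous t1 x s : continuous s -> continuous (picard t1 x s).
Proof.
move=> cs t; apply: cvgD; first exact: cvg_cst.
apply: cvgB; last exact: cvg_cst.
apply: (@within_clamp_continuous _ T _ (prim (fun u => A (s u) (clamp T u)))) => //.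
exact: is_derive_within_segment (primP (Acomp cs)).
Qed.

Let picard_derive t1 x s : continuous s ->
  forall t, t \in `[0, T] ->
    is_derive_within [set` `[0, T]] (picard t1 x s) t (A (s t) t).
Proof.
move=> cs t tT; have := primP (Acomp cs) tT; rewrite clamp_id// => H.
apply: cvg_trans H.
apply: near_eq_cvg; rewrite near_withinE; near=> u => uT.
rewrite /picard !clamp_id//; congr (_ *: _).
by rewrite [in RHS]opprD addrACA subrr add0r opprB addrA subrK.
Unshelve. all: by end_near. Qed.

(* The weight exp (2K|t - t1|) makes the Picard map a 1/2-contraction on the
   whole of [0, T]. *)
Lemma ode_exists t1 x : t1 \in `[0, T] -> exists s, s t1 = x /\ solves s.
Proof.
move=> t1T; have [s [cs st1 s0 ds]] : exists s : nat -> R -> 'rV[R]_d,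
    [/\ forall n, continuous (s n), forall n, s n t1 = x, s 0%N = cst x
      & forall n t, t \in `[0, T] ->
        is_derive_within [set` `[0, T]] (s n.+1) t (A (s n t) t)].
  pose s n := iter n (picard t1 x) (cst x).
  have cs n : continuous (s n).
    by elim: n => [|n IH]; [exact: cst_continuous|exact: picard_continuous].
  exists s; split => //; last by move=> n t tT; exact: picard_derive.
  by case=> [//|n]; rewrite /s /= /picard clamp_id// subrr addr0.
pose E t := expR (2 * K * `|t - t1|).
have k0 : 0 < 2 * K by rewrite mulr_gt0.
have E1 t : 1 <= E t by rewrite -expR0 ler_expR mulr_ge0 ?(ltW k0).
have EE t : t \in `[0, T] -> E t <= expR (2 * K * T).
  move=> tT; rewrite ler_expR ler_wpM2l ?(ltW k0)//.
  by move: tT t1T; rewrite !in_itv/= ler_norml => /andP[? ?] /andP[? ?]; apply/andP; split; lra.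
have [|c cT hc] := @EVT_max R (fun t => `|s 1%N t - s 0%N t|) 0 T T0.
  apply: continuous_subspaceT => t; apply: cvg_norm.
  by apply: cvgB; exact: cs.
set C := `|s 1%N c - s 0%N c| in hc; have C0 : 0 <= C by exact: normr_ge0.
have step n t : t \in `[0, T] -> `|s n.+1 t - s n t| <= C * 2^-1 ^+ n * E t.
  elim: n t => [|n IH] t tT.
    rewrite expr0 mulr1; apply: le_trans (hc _ tT) _.
    by rewrite ler_peMr ?E1.
  have H u : u \in `[0, T] -> is_derive_within [set` `[0, T]] (fun u => s n.+2 u - s n.+1 u) u
      (A (s n.+1 u) u - A (s n u) u).
    move=> uT; apply: is_derive_withinB.
      exact: ds.
    exact: ds.
  have := @exp_growth_rV _ _ T t1 (2 * K) (K * (C * 2^-1 ^+ n)) _ _ k0 t1T H _ t tT.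
  rewrite !st1 subrr subr0.
  have -> : K * (C * 2^-1 ^+ n) / (2 * K) = C * 2^-1 ^+ n.+1.
    by rewrite exprS; field; rewrite gt_eqF.
  apply => u uT; apply: le_trans (Alip _ _ uT) _.
  by rewrite -mulrA ler_wpM2l ?(ltW K0)//; exact: IH.
pose C' := C * expR (2 * K * T).
have C'0 : 0 <= C' by rewrite mulr_ge0 ?expR_ge0.
(* The right-hand side is the exact partial sum of the geometric series of step bounds C' / 2^i for
   i from n to n + m - 1. *)
have tele n m t : t \in `[0, T] ->
    `|s (n + m)%N t - s n t| <= 2 * C' * (2^-1 ^+ n - 2^-1 ^+ (n + m)).
  move=> tT; elim: m => [|m IH]; first by rewrite addn0 !subrr normr0 mulr0.
  rewrite addnS -[X in `|X|](subrKA (s (n + m)%N t)).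
  apply: le_trans (ler_normD _ _) _.
  have := step (n + m)%N t tT; have := EE t tT => hE hs.
  have : C * 2^-1 ^+ (n + m) * E t <= C' * 2^-1 ^+ (n + m).
    by rewrite /C' mulrAC ler_wpM2r ?exprn_ge0// ?ler_wpM2l//; lra.
  rewrite exprS; move: IH hs; lra.
have hpow : 2 * C' * 2^-1 ^+ n @[n --> \oo] --> (0 : R).
  by apply: (@cvg_geometric R (2 * C') 2^-1); rewrite ger0_norm; lra.
have teleN n m t : t \in `[0, T] -> (n <= m)%N ->
    `|s m t - s n t| <= 2 * C' * 2^-1 ^+ n.
  move=> tT nm; rewrite -(subnKC nm); apply: le_trans (tele _ _ _ tT) _.
  by rewrite ler_wpM2l ?mulr_ge0// gerDl oppr_le0 exprn_ge0.
have cau t : t \in `[0, T] -> cvg (s n t @[n --> \oo]).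
  move=> tT; apply/cauchy_cvgP/cauchy_exP => e e0.
  have [N _ HN] := @cvgr0_norm_lt _ _ _ _ eventually_filter _ hpow _ e0.
  exists (s N t); exists N => // m /= Nm.
  rewrite -ball_normE /= distrC; apply: le_lt_trans (teleN _ _ _ tT Nm) _.
  by apply: le_lt_trans (HN N (leqnn N)); exact: ler_norm.
pose sl t := limn (fun n => s n (clamp T t)).
have slE n t : `|sl t - s n (clamp T t)| <= 2 * C' * 2^-1 ^+ n.
  have cT' := clamp_in t T0.
  have H : `|s m (clamp T t) - s n (clamp T t)| @[m --> \oo] --> `|sl t - s n (clamp T t)|.
    by apply: cvg_norm; apply: cvgB; [exact: cau|exact: cvg_cst].
  rewrite -(cvg_lim _ H)//; apply: limr_le; first by apply/cvg_ex; eexists; exact: H.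
  by exists n => // m /= nm; exact: teleN.
have csl : continuous sl.
  move=> t; apply/cvgrPdist_lt => e e0.
  have e3 : 0 < e / 3 by lra.
  have [N _ HN] := @cvgr0_norm_lt _ _ _ _ eventually_filter _ hpow _ e3.
  have {}HN : 2 * C' * 2^-1 ^+ N < e / 3.
    by apply: le_lt_trans (HN N (leqnn N)); exact: ler_norm.
  have cN : continuous (s N \o clamp T).
    by move=> u; apply: continuous_comp; [exact: clamp_continuous|exact: cs].
  have /cvgrPdist_lt /(_ _ e3) := cN t.
  apply: filterS => u /= hu.
  have := slE N t; have := slE N u; set p := s N _; set q := s N _ in hu * => h1 h2.
  rewrite -(subrKA q) -[X in `|_ + X|](subrKA p).
  apply: le_lt_trans (ler_normD _ _) _.
  apply: le_lt_trans (lerD (lexx _) (ler_normD _ _)) _.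
  rewrite (distrC p (sl u)); lra.
pose sp := picard t1 x sl.
(* The limit [sl] is not differentiated. Its Picard image [sp] has derivative A(sl t, t) by
   construction, and both are geometrically close to the iterate [s n.+1], hence equal. *)
have spE t : t \in `[0, T] -> sl t = sp t.
  move=> tT; apply/eqP; rewrite -subr_eq0 -normr_le0.
  apply: (@geometric_le0 _ _ (2 * C' + 2 * C' * expR (2 * K * T))) => n.
  rewrite -(subrKA (s n.+1 t)); apply: le_trans (ler_normD _ _) _.
  have h1 := slE n.+1 t; rewrite clamp_id// in h1.
  have H u : u \in `[0, T] -> is_derive_within [set` `[0, T]] (fun u => s n.+1 u - sp u) u
      (A (s n u) u - A (sl u) u).
    move=> uT; apply: is_derive_withinB.
      exact: ds.
    exact: (picard_derive t1 x csl uT).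
  have := @exp_growth_rV _ _ T t1 (2 * K) (K * (2 * C' * 2^-1 ^+ n)) _ _ k0 t1T H _ t tT.
  have -> : sp t1 = x by rewrite /sp /picard clamp_id// subrr addr0.
  rewrite !st1 subrr subr0 => {}H; apply: le_trans (lerD h1 (H _)) _.
    move=> u uT; apply: le_trans (Alip _ _ uT) _.
    rewrite -mulrA ler_wpM2l ?(ltW K0)// distrC.
    have := slE n u; rewrite clamp_id// => h2; apply: le_trans h2 _.
    by rewrite ler_peMr ?E1// !mulr_ge0 ?exprn_ge0.
  have -> : K * (2 * C' * 2^-1 ^+ n) / (2 * K) = C' * 2^-1 ^+ n.
    by field; rewrite gt_eqF.
  have p0 : 0 <= C' * 2^-1 ^+ n by rewrite mulr_ge0 ?exprn_ge0.
  rewrite exprS.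
  have : C' * 2^-1 ^+ n * expR (2 * K * `|t - t1|) <= C' * 2^-1 ^+ n * expR (2 * K * T).
    by rewrite ler_wpM2l// EE.
  have : 0 <= C' * 2^-1 ^+ n * expR (2 * K * T) by rewrite mulr_ge0// expR_ge0.
  move: (expR _) (expR _) p0 => y z; lra.
exists sp; split; first by rewrite /sp /picard clamp_id// subrr addr0.
by move=> t tT; rewrite -spE//; exact: picard_derive.
Qed.

Notation D := (flow A T).

Lemma flow_solution t1 x : t1 \in `[0, T] -> ode_solution A T t1 x (fun t => D t1 t x).
Proof.
move=> t1T; have [s [s1 hs]] := ode_exists x t1T.
by apply: (@xgetPex _ (fun=> 0) (ode_solution A T t1 x)); exists s.
Qed.

Lemma flow_unique t1 t x s : t1 \in `[0, T] -> t \in `[0, T] ->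
  ode_solution A T t1 x s -> D t1 t x = s t.
Proof.
move=> t1T tT [s1 hs]; have [f1 hf] := flow_solution x t1T.
apply/eqP; rewrite -subr_eq0 -normr_le0.
by apply: le_trans (ode_lipschitz t1T hf hs tT) _; rewrite f1 s1 subrr normr0 mulr0.
Qed.

Lemma flow_id t x : t \in `[0, T] -> D t t x = x.
Proof. by move=> tT; have [] := flow_solution x tT. Qed.

Lemma flow_comp a b c x : a \in `[0, T] -> b \in `[0, T] -> c \in `[0, T] ->
  D b c (D a b x) = D a c x.
Proof.
move=> aT bT cT; apply: (@flow_unique b c _ (fun t => D a t x)) => //.
by split=> //; have [] := flow_solution x aT.
Qed.

Lemma flowK a b x : a \in `[0, T] -> b \in `[0, T] -> D b a (D a b x) = x.
Proof. by move=> aT bT; rewrite flow_comp// flow_id. Qed.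

Lemma flow_lipschitz a b x y : a \in `[0, T] -> b \in `[0, T] ->
  `|D a b x - D a b y| <= 2 * expR (2 * K * T) * `|x - y|.
Proof.
move=> aT bT; have [hx sx] := flow_solution x aT; have [hy sy] := flow_solution y aT.
by have := ode_lipschitz aT sx sy bT; rewrite hx hy.
Qed.

(** The orbit of the origin is bounded on [0, T] by compactness, and D_{a -> b} x is compared with
    D_{0 -> b} 0, the image under D_{a -> b} of D_{0 -> a} 0, by the Lipschitz bound. Uniformity in
    both times lets the flow be run backwards to locate supports. *)
Lemma flow_bounded : exists C, 0 <= C /\ forall a b x, a \in `[0, T] -> b \in `[0, T] ->
  `|D a b x| <= C * (1 + `|x|).
Proof.
have z0 : 0 \in `[0, T] by rewrite in_itv/= lexx.
have [h0 s0] := flow_solution (0 : 'rV[R]_d) z0.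
have [|c cT hc] := @EVT_max R (fun t => `|D 0 t 0|) 0 T T0.
  by move=> t; apply: cvg_norm; exact: (is_derive_within_segment s0).
set P := `|D 0 c 0| in hc; set E := 2 * expR (2 * K * T).
have E0 : 0 <= E by rewrite mulr_ge0 ?expR_ge0.
have P0 : 0 <= P by exact: normr_ge0.
have EP : 0 <= E * P by rewrite mulr_ge0.
exists (P + E * P + E); split; first lra.
move=> a b x aT bT; rewrite -[X in `|X|](subrK (D 0 b 0)).
apply: le_trans (ler_normD _ _) _; rewrite -(flow_comp 0 z0 aT bT).
apply: le_trans (lerD (flow_lipschitz _ _ aT bT) (le_refl _)) _.
rewrite flow_comp// -/E; have h1 := hc _ bT; have h2 := hc _ aT.
have : E * `|x - D 0 a 0| <= E * (`|x| + P).
  by rewrite ler_wpM2l//; apply: le_trans (ler_normB _ _) _; rewrite lerD2l.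
have : 0 <= (P + E * P) * `|x| by rewrite mulr_ge0// addr_ge0.
lra.
Qed.

(** The mean value point depends on the coordinate, hence the scalar form. *)
Lemma flow_increment a b x i : a \in `[0, T] -> b \in `[0, T] -> a <= b ->
  exists2 c, c \in `[a, b] &
    D a b x ord0 i - x ord0 i = A (D a c x) c ord0 i * (b - a).
Proof.
move=> aT bT ab; have [h0 s0] := flow_solution x aT.
have si t : t \in `[0, T] -> is_derive_within [set` `[0, T]]
    (fun u => D a u x ord0 i) t (A (D a t x) t ord0 i).
  by move=> tT; exact: is_derive_within_coord (s0 t tT).
have sub (u : R) : u \in `[a, b] -> u \in `[0, T].
  move: aT bT; rewrite !in_itv/= => /andP[? ?] /andP[? ?] /andP[? ?].
  by apply/andP; split; lra.
have [| |c cab E] := @MVT_segment R (fun u => D a u x ord0 i) (fun t => A (D a t x) t ord0 i) a b ab.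
- move=> u uab; apply: is_derive_within_interior (si u _).
    move: aT bT uab; rewrite !in_itv/= => /andP[? ?] /andP[? ?] /andP[? ?].
    by apply/andP; split; lra.
  by apply: sub; exact: subset_itv_oo_cc.
- exact: continuous_subspaceW sub (is_derive_within_segment si).
- by exists c => //; rewrite -E flow_id.
Qed.

End ode.

(** * Borel sets of row vectors *)

Lemma natSinv_lt (R : realType) (e : R) : 0 < e -> exists n : nat, n.+1%:R^-1 < e.
Proof.
by move=> e0; have [n _ Hn] := near_infty_natSinv_lt (PosNum e0); exists n; exact: Hn n (leqnn n).
Qed.

Lemma cvge_near_lt (R : realType) (S : Type) (F : set_system S) (f : S -> \bar R)
    (l e : \bar R) : f @ F --> l -> (l < e)%E -> \forall x \near F, (f x < e)%E.
Proof.
move=> fl le; apply: (fl [set y | (y < e)%E]); apply: open_nbhs_nbhs.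
by split=> //; exact: open_ereal_lt_ereal.
Qed.

Section rV_borel.
Context (R : realType) (d : nat).
Implicit Types (O C F : set 'rV[R]_d).

Lemma rV_normrN_coord (q v : 'rV[R]_d) r : 0 <= r ->
  (`|v - q| <= r) <-> forall i, `|v ord0 i - q ord0 i| <= r.
Proof.
move=> r0; split=> [H i|H]; last by apply: mx_norm_le => // i; rewrite !mxE.
by apply: le_trans H; have := mx_norm_coord (v - q) i; rewrite !mxE.
Qed.

Lemma measurable_rV_cube (q : 'rV[R]_d) (r : R) : 0 <= r ->
  measurable [set v : 'rV[R]_d | `|v - q| <= r].
Proof.
move=> r0; rewrite (_ : [set v | _] = \bigcap_(i in [set: 'I_d])
    ((fun v : 'rV[R]_d => v ord0 i) @^-1` `[q ord0 i - r, q ord0 i + r])).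
  apply: fin_bigcap_measurable => [|i _]; first exact: finite_finset.
  by rewrite -[X in measurable X]setTI; exact: (@measurable_rV_coord R d i).
apply/seteqP; split=> v /=.
  move=> /(rV_normrN_coord _ _ r0) H i _ /=.
  by rewrite in_itv/= -ler_distl.
move=> H; apply/(rV_normrN_coord _ _ r0) => i.
by have := H i I; rewrite /= in_itv/= -ler_distl.
Qed.

Lemma measurable_rV_cube0 (r : R) : 0 <= r -> measurable [set v : 'rV[R]_d | `|v| <= r].
Proof. by move=> r0; have := measurable_rV_cube 0 r0; under eq_fun do rewrite subr0. Qed.

Lemma rV_rat_approx (x : 'rV[R]_d) (e : R) : 0 < e ->
  exists q : 'rV[rat]_d, `|x - map_mx ratr q| <= e.
Proof.
move=> e0; have /choice[q Hq] (i : 'I_d) : exists q : rat, `|x ord0 i - ratr q| <= e.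
  have xb : ball (x ord0 i) e !=set0 by exists (x ord0 i); exact: ballxx.
  have [y [xq [q _ qy]]] := @dense_rat R _ xb (ball_open _ _).
  by exists q; move: xq; rewrite -qy; rewrite -ball_normE /= => /ltW.
exists (\row_i q i); apply/(rV_normrN_coord _ _ (ltW e0)) => i.
by rewrite !mxE.
Qed.

Lemma rV_openP O : open O <->
  forall x, O x -> exists2 e : R, 0 < e & forall y, `|y - x| < e -> O y.
Proof.
rewrite openE; split=> H x Ox.
  have /nbhs_ballP[e e0 He] := H x Ox; exists e => // y yx; apply: He.
  by rewrite -ball_normE /= distrC.
have [e e0 He] := H x Ox; apply/nbhs_ballP; exists e => // y.
by rewrite -ball_normE /= distrC => /He.
Qed.

(** The sigma-algebra is generated by the coordinates. Balls of the sup norm are cubes, hence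
    measurable, and [O] is the union of the countably many closed cubes with rational centre and
    radius 1/(n+1) that it contains; [Q] enumerates them through [pickle]. *)
Lemma open_measurable_rV O : open O -> measurable O.
Proof.
move=> /rV_openP oO.
pose Q (k : nat) : set 'rV[R]_d := if unpickle k is Some (q, n) then
  let C := [set v : 'rV[R]_d | `|v - map_mx ratr q| <= n.+1%:R^-1] in
  if `[< C `<=` O >] then C else set0 else set0.
have -> : O = \bigcup_k Q k.
  apply/seteqP; split => [x Ox|x [k _]]; last first.
    by rewrite /Q; case: unpickle => [[q n]|//] /=; case: asboolP => // H /H.
  have [e e0 He] := oO _ Ox.
  have e2 : 0 < e / 2 by lra.
  have [n hn] := natSinv_lt e2.
  have n0 : 0 < n.+1%:R^-1 :> R by rewrite invr_gt0.
  have [q hq] := rV_rat_approx x n0.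
  exists (pickle (q, n)) => //; rewrite /Q pickleK.
  case: asboolP => // H; exfalso; apply: H => y /= hy; apply: He.
  rewrite -(subrKA (map_mx ratr q)); apply: le_lt_trans (ler_normD _ _) _.
  by rewrite (distrC _ x) (splitr e) ler_ltD ?(le_lt_trans hq)// (le_trans hy)// ltW.
apply: bigcupT_measurable => k; rewrite /Q.
case: unpickle => [[q n]|//] /=; case: ifP => // _.
by apply: measurable_rV_cube; rewrite invr_ge0.
Qed.

Lemma closed_measurable_rV C : closed C -> measurable C.
Proof.
by move=> cC; rewrite -(setCK C); apply: measurableC; apply: open_measurable_rV;
  exact: closed_openC.
Qed.

Lemma continuous_measurable_rV (f : 'rV[R]_d -> measurableTypeR R) :
  continuous (f : 'rV[R]_d -> R) -> measurable_fun [set: 'rV[R]_d] f.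
Proof.
move=> cf; apply: (measurability _ (RGenOpens.measurableE R)).
move=> _ [_ [a [b ->]] <-]; rewrite setTI; apply: open_measurable_rV.
by move/continuousP : cf; apply; exact: interval_open.
Qed.

Lemma continuous_measurable_rV_rV d' (f : 'rV[R]_d -> 'rV[R]_d') :
  continuous f -> measurable_fun [set: 'rV[R]_d] f.
Proof.
move=> cf; apply: measurable_fun_rVP => i; apply: continuous_measurable_rV => x.
exact: (continuous_cvg _ (@coord_continuous R 1 d' ord0 i (f x)) (cf x)).
Qed.

Section regularity.
Context (mu : {measure set 'rV[R]_d -> \bar R}).
Hypothesis mu_fin : (mu setT < +oo)%E.

(** The inner approximation by closed sets is carried along because complementation exchanges it
    with the outer one; this makes the regular sets a sigma-algebra. *)
Let regular F := measurable F /\ forall e : R, 0 < e -> exists O C,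
  [/\ open O, closed C, C `<=` F, F `<=` O & (mu (O `\` C) < e%:E)%E].

Let regularC F : regular F -> regular (~` F).
Proof.
move=> [mF rF]; split; first exact: measurableC.
move=> e /rF [] O [] C [] oO cC CF FO muOC; exists (~` C), (~` O); split.
- exact: closed_openC.
- exact: open_closedC.
- exact: subsetC.
- exact: subsetC.
- by rewrite setDE setCK setIC -setDE.
Qed.

Let regular_bigcup (F : (set 'rV[R]_d)^nat) :
  (forall n, regular (F n)) -> regular (\bigcup_n F n).
Proof.
move=> rF; have mF : measurable (\bigcup_n F n).
  by apply: bigcupT_measurable => n; exact: (rF n).1.
split=> // e e0.
have e2 : 0 < e / 2 by lra.
have /choice[OC HOC] n : exists OC : set 'rV[R]_d * set 'rV[R]_d,
  [/\ open OC.1, closed OC.2, OC.2 `<=` F n, F n `<=` OC.1 &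
    (mu (OC.1 `\` OC.2) < (e / 2 / (2 ^ n.+1)%:R)%:E)%E].
  have [|O [C H]] := (rF n).2 (e / 2 / (2 ^ n.+1)%:R).
    by rewrite divr_gt0// ltr0n expn_gt0.
  by exists (O, C).
(* A countable union of closed sets may fail to be closed, so only finite unions [C n] are used. The
   excess over them decreases to a set of measure at most e/2, and continuity from above applies
   since [mu] is finite. *)
pose O := \bigcup_n (OC n).1; pose C n := \big[setU/set0]_(i < n) (OC i).2.
have oO : open O by apply: bigcup_open => n _; have [] := HOC n.
have cC n : closed (C n).
  by apply: closed_bigsetU => i _; have [] := HOC i.
have mC n : measurable (C n) by exact: closed_measurable_rV.
have mO : measurable O by exact: open_measurable_rV.
pose G n := O `\` C n.
have mG n : measurable (G n) by exact: measurableD.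
have mCG : measurable (\bigcap_n G n) by apply: bigcapT_measurable.
have niG : nonincreasing_seq G.
  move=> m n mn; apply/subsetPset; apply: setDS; rewrite /C.
  exact: (@subset_bigsetU _ (fun i => (OC i).2)).
have muG n : (mu (G n) < +oo)%E.
  by apply: le_lt_trans mu_fin; apply: le_measure; rewrite ?inE.
have := nonincreasing_cvg_mu (muG 0%N) mG mCG niG => cvgG.
have small : (mu (\bigcap_n G n) < e%:E)%E.
  apply: (@le_lt_trans _ _ (e / 2)%:E); last by rewrite lte_fin; lra.
  apply: le_trans (_ : (mu (\bigcap_n G n) <=
      \sum_(i <oo) mu ((OC i).1 `\` (OC i).2))%E) _.
    apply: measure_sigma_subadditive => //.
      move=> i; have [? ? _ _ _] := HOC i.
      by apply: measurableD; [exact: open_measurable_rV|exact: closed_measurable_rV].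
    (* The closed set of index [n] belongs to the partial unions only from [C n.+1] on. *)
    move=> x xG; have [[n _ xn] _] := xG 0%N I; exists n => //; split => // xC.
    have [_ ] := xG n.+1 I; apply; rewrite /C big_ord_recr /=; right; exact: xC.
  apply: le_trans (epsilon_trick0 xpredT (ltW e2)); apply: lee_nneseries => // i _.
  by have [_ _ _ _ /ltW] := HOC i.
have [N _ HN] : \forall n \near \oo, (mu (G n) < e%:E)%E.
  exact: cvge_near_lt cvgG small.
exists O, (C N); split => //.
- move=> x; rewrite /C -(bigcup_mkord _ (fun i => (OC i).2)) => -[i _ xi]; exists i => //.
  by have [_ _ + _ _] := HOC i; apply.
- move=> x [i _ xi]; exists i => //.
  by have [_ _ _ + _] := HOC i; apply.
- exact: HN N (leqnn N).
Qed.

Let regular0 : regular set0.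
Proof.
split=> // e e0; exists set0, set0; split => //.
- exact: closed0.
- by rewrite setD0 measure0 lte_fin.
Qed.

Let regular_ray i (a : R) :
  regular ((fun v : 'rV[R]_d => v ord0 i) @^-1` `]a, +oo[).
Proof.
set F := _ @^-1` _.
have oF : open F.
  apply: open_comp; last exact: interval_open.
  by move=> x _; exact: coord_continuous.
have mF := open_measurable_rV oF.
split=> // e e0; pose C n : set 'rV[R]_d :=
  (fun v : 'rV[R]_d => v ord0 i) @^-1` `[a + n.+1%:R^-1, +oo[.
have cC n : closed (C n).
  apply: closed_comp; last exact: interval_closed.
  by move=> x _; exact: coord_continuous.
have mG n : measurable (F `\` C n).
  by apply: measurableD => //; exact: closed_measurable_rV.
have niG : nonincreasing_seq (fun n => F `\` C n).
  move=> m n mn; apply/subsetPset; apply: setDS => x; rewrite /C /= !in_itv/= !andbT.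
  by apply: le_trans; rewrite lerD2l lef_pV2 ?posrE// ler_nat.
have G0 : \bigcap_n (F `\` C n) = set0.
  rewrite -subset0 => x H; have [] := H 0%N I.
  rewrite /F /= in_itv/= andbT => ax _.
  have ax' : 0 < x ord0 i - a by rewrite subr_gt0.
  have [n hn] := natSinv_lt ax'.
  have [_] := H n I; apply; rewrite /C /= in_itv/= andbT.
  by rewrite -lerBrDl ltW.
have muG0 : (mu (F `\` C 0%N) < +oo)%E.
  by apply: le_lt_trans mu_fin; apply: le_measure; rewrite ?inE.
have := nonincreasing_cvg_mu muG0 mG; rewrite G0 => /(_ measurable0 niG).
rewrite measure0 => cvgG.
have [N _ HN] : \forall n \near \oo, (mu (F `\` C n) < e%:E)%E.
  by apply: cvge_near_lt cvgG _; rewrite lte_fin.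
exists F, (C N); split => //; last exact: HN N (leqnn N).
move=> x; rewrite /C /F /= !in_itv/= !andbT; apply: lt_le_trans.
by rewrite ltrDl invr_gt0.
Qed.

Lemma measurable_outer_regular F : measurable F -> forall e : R, 0 < e ->
  exists O, [/\ open O, F `<=` O & (mu (O `\` F) < e%:E)%E].
Proof.
move=> mF e e0; suff : regular F.
  move=> [_ /(_ _ e0)] [] O [] C [] oO cC CF FO mu_e; exists O; split => //.
  apply: le_lt_trans mu_e; apply: le_measure; rewrite ?inE.
  - by apply: measurableD => //; exact: open_measurable_rV.
  - by apply: measurableD; [exact: open_measurable_rV|exact: closed_measurable_rV].
  - exact: setDS.
have sa : sigma_algebra setT regular.
  by split => // G rG; rewrite setTD; exact: regularC.
move: mF; apply: smallest_sub => //.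
case: d mu mu_fin regular regularC regular_bigcup regular0 regular_ray sa
  => [|n] mu' fin' reg rC rU r0 rr sa; first by rewrite big_ord0.
rewrite -bigcup_mkord_ord; apply: bigcup_sub => i _ _ [B mB <-]; rewrite setTI.
move: B mB; rewrite RGenOInfty.measurableE; apply: smallest_sub => //=.
  split; first by rewrite preimage_set0.
    by move=> A; rewrite setTD preimage_setC; exact: rC.
  by move=> G HG; rewrite preimage_bigcup; exact: rU.
by move=> _ [a ->]; exact: rr.
Qed.

End regularity.
End rV_borel.

(** * Integration along an axis and shears *)

Lemma continuous_mulr_fun (R : realType) (X : topologicalType) (f g : X -> R) :
  continuous f -> continuous g -> continuous (fun x => f x * g x).
Proof. by move=> cf cg x; apply: cvgM; [exact: cf|exact: cg]. Qed.

Lemma continuous_add1r_fun (R : realType) (X : topologicalType) (f : X -> R) :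
  continuous f -> continuous (fun x => 1 + f x).
Proof. by move=> cf x; apply: cvgD; [exact: cvg_cst|exact: cf]. Qed.

Definition rV_upd (R : Type) d (x : 'rV[R]_d) (i : 'I_d) (s : R) : 'rV[R]_d :=
  \row_j (if j == i then s else x ord0 j).

Lemma rV_upd_cons0 (R : realType) d (a s : R) (v : 'rV[R]_d) :
  rV_upd (rV_cons (a, v)) ord0 s = rV_cons (s, v).
Proof.
apply/rowP => j; rewrite !mxE /=; case: unliftP => [k ->|->]; last by rewrite eqxx.
by rewrite eq_sym (negbTE (neq_lift _ _)).
Qed.

Lemma rV_upd_cons_lift (R : realType) d (a s : R) (v : 'rV[R]_d) (j : 'I_d) :
  rV_upd (rV_cons (a, v)) (lift ord0 j) s = rV_cons (a, rV_upd v j s).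
Proof.
apply/rowP => k; rewrite !mxE /=; case: unliftP => [l ->|->].
  by rewrite (inj_eq (@lift_inj _ ord0)) mxE.
by rewrite (negbTE (neq_lift _ _)).
Qed.

Lemma ge0_integral_rV_cons (R : realType) d (f : 'rV[R]_d.+1 -> \bar R) :
  measurable_fun [set: 'rV[R]_d.+1] f -> (forall x, 0 <= f x)%E ->
  (\int[lebesgue_rV R d.+1]_x f x =
   \int[(@lebesgue_measure R \x lebesgue_rV R d)%E]_p f (rV_cons p))%E.
Proof.
move=> mf f0.
have := @ge0_integral_pushforward _ _ _ _ R _ (@measurable_rV_cons R d)
  (@lebesgue_measure R \x lebesgue_rV R d)%E setT f measurableT mf (fun y _ => f0 y).
by rewrite preimage_setT.
Qed.

(* Tonelli along the [i]-th axis, stated as a comparison of two integrals so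
   that the remaining coordinates need no measure of their own. *)
Lemma ge0_eq_integral_axis (R : realType) d (i : 'I_d) (f g : 'rV[R]_d -> \bar R) :
  measurable_fun [set: 'rV[R]_d] f -> measurable_fun [set: 'rV[R]_d] g ->
  (forall x, 0 <= f x)%E -> (forall x, 0 <= g x)%E ->
  (forall x, \int[@lebesgue_measure R]_s f (rV_upd x i s) =
             \int[@lebesgue_measure R]_s g (rV_upd x i s))%E ->
  (\int[lebesgue_rV R d]_x f x = \int[lebesgue_rV R d]_x g x)%E.
Proof.
elim: d i f g => [[]//|d IH] i f g mf mg f0 g0 H.
rewrite !ge0_integral_rV_cons//.
have mfc : measurable_fun setT (f \o @rV_cons R d).
  exact: measurableT_comp mf (@measurable_rV_cons R d).
have mgc : measurable_fun setT (g \o @rV_cons R d).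
  exact: measurableT_comp mg (@measurable_rV_cons R d).
(* An axis other than the first is treated by induction inside the outer integral over the first
   coordinate; for the first axis Tonelli is used in the other order. *)
case: (unliftP ord0 i) => [j|] ij.
  rewrite (@fubini_tonelli1 _ _ _ _ R _ _ (f \o @rV_cons R d))//; last by move=> x; exact: f0.
  rewrite (@fubini_tonelli1 _ _ _ _ R _ _ (g \o @rV_cons R d))//; last by move=> x; exact: g0.
  apply: eq_integral => a _; rewrite /fubini_F /=; apply: (IH j).
  - by apply: measurableT_comp mfc _; exact: measurable_pair1.
  - by apply: measurableT_comp mgc _; exact: measurable_pair1.
  - by move=> x; exact: f0.
  - by move=> x; exact: g0.
  - move=> v; have := H (rV_cons (a, v)); rewrite ij.
    by under eq_integral do rewrite rV_upd_cons_lift;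
       under [in RHS]eq_integral do rewrite rV_upd_cons_lift.
rewrite (@fubini_tonelli2 _ _ _ _ R _ _ (f \o @rV_cons R d))//; last by move=> x; exact: f0.
rewrite (@fubini_tonelli2 _ _ _ _ R _ _ (g \o @rV_cons R d))//; last by move=> x; exact: g0.
apply: eq_integral => v _; rewrite /fubini_G /=.
(* The 0 is a placeholder, overwritten by [rV_upd]. *)
have := H (rV_cons (0, v)); rewrite ij.
by under eq_integral do rewrite rV_upd_cons0;
   under [in RHS]eq_integral do rewrite rV_upd_cons0.
Qed.

Lemma lebesgue_rV_cube_lty (R : realType) d (r : R) :
  (lebesgue_rV R d [set v : 'rV[R]_d | (`|v| <= r)%R] < +oo)%E.
Proof.
have [r0|r0] := leP 0 r; last first.
  rewrite (_ : [set v | _] = set0) ?measure0//.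
  by rewrite -subset0 => v /= /(le_trans (normr_ge0 v)); rewrite leNgt r0.
have mE d' : measurable [set v : 'rV[R]_d' | `|v| <= r].
  by have := measurable_rV_cube (0 : 'rV[R]_d') r0; under eq_fun do rewrite subr0.
elim: d => [|d IH].
  by rewrite /= /lebesgue_rV_zero diracE; case: (_ \in _); rewrite ltry.
rewrite [X in (X < _)%E](_ : _ = (@lebesgue_measure R \x lebesgue_rV R d)%E
    (@rV_cons R d @^-1` [set v | (`|v| <= r)%R]))//.
apply: (@le_lt_trans _ _ ((@lebesgue_measure R \x lebesgue_rV R d)%E
  (`[- r, r]%classic `*` [set v | (`|v| <= r)%R]))).
  apply: le_measure; rewrite ?inE.
  - rewrite -[X in measurable X]setTI; apply: measurable_rV_cons => //; exact: mE.
  - by apply: measurableX; [exact: measurable_itv|exact: mE].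
  - move=> [a v] /= H; split => /=.
      have := le_trans (mx_norm_coord _ ord0) H.
      by rewrite mxE unlift_none /= ler_norml in_itv.
    apply: mx_norm_le => // i; have := le_trans (mx_norm_coord _ (lift ord0 i)) H.
    by rewrite mxE liftK.
rewrite product_measure1E//; last exact: mE.
have lf : (@lebesgue_measure R `[(- r)%R, r] < +oo)%E.
  by rewrite lebesgue_measure_itv /= lte_fin; case: ifP => _; rewrite ?ltry// -EFinB ltry.
by apply: lte_mul_pinfty => //; rewrite ge0_fin_numE.
Qed.

(** The substitution rule is applied on one segment. Since [F] expands distances by at least 1/2, a
    large enough segment contains all points where [v o F] is nonzero, and its image contains the
    support of [v]. *)
Lemma integral_substitution_compact_support (R : realType) (F F' v : R -> R) (r : R) :
  (forall s : R, is_derive s 1 F (F' s)) -> continuous F' -> (forall s, 2^-1 <= F' s) ->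
  continuous v -> (forall s, r < `|s| -> v s = 0) ->
  (\int[@lebesgue_measure R]_s (v (F s) * F' s)%:E =
   \int[@lebesgue_measure R]_s (v s)%:E)%E.
Proof.
move=> dF cF' F'h cv vr.
have F'E : (F^`())%classic = F'.
  by apply/funext => s; rewrite derive1E; have [_ ->] := dF s.
have cF : continuous F.
  move=> s; apply/differentiable_continuous/derivable1_diffP.
  by have [] := dF s.
have growth a b : a <= b -> 2^-1 * (b - a) <= F b - F a.
  move=> ab; have [|c _ ->] := @MVT_segment R F F' a b ab (fun s _ => dF s).
    exact: continuous_subspaceT.
  by rewrite ler_wpM2r// subr_ge0.
(* The factor 2 undoes the slope 1/2: moving from 0 to [b] raises [F] by at least |F 0| + |r| + 1,
   which gives [F b > r], and likewise [F (- b) < - r]. *)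
pose b := 2 * (`|F 0| + `|r| + 1).
have b0 : 0 <= b by rewrite mulr_ge0// !addr_ge0.
have b0' : - b <= 0 by rewrite oppr_le0.
have h1 : r < F b.
  have := growth 0 b b0; rewrite /b subr0 mulKf//.
  have := ler_norm r; have := ler_norm (- F 0); rewrite normrN; lra.
have h2 : F (- b) < - r.
  have := growth (- b) 0 b0'; rewrite opprK add0r /b mulKf//.
  have := ler_norm r; have := ler_norm (F 0); lra.
have F_gt s : b < s -> r < F s.
  by move=> bs; have := growth b s (ltW bs); lra.
have F_lt s : s < - b -> F s < - r.
  by move=> bs; have := growth s (- b) (ltW bs); lra.
have bb : - b <= b by lra.
have v_gt s : r < s -> v s = 0.
  by move=> rs; apply: vr; apply: lt_le_trans rs (ler_norm _).
have v_lt s : s < - r -> v s = 0.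
  by move=> rs; apply: vr; rewrite -normrN; apply: lt_le_trans (ler_norm _); lra.
have := @integration_by_substitution_increasing R F v (- b) b bb.
rewrite F'E => H.
transitivity (\int[lebesgue_measure]_(x in `[(- b)%R, b]) (((v \o F) * F')%R x)%:E)%E.
  rewrite [RHS]integral_mkcond; apply: eq_integral => s _.
  rewrite patchE; case: ifPn => //; rewrite notin_setE /= in_itv/= => /negP.
  rewrite negb_and -!ltNge => /orP[/F_lt/v_lt ->|/F_gt/v_gt ->]; by rewrite mul0r.
rewrite -H.
- rewrite [LHS]integral_mkcond; apply: eq_integral => s _.
  rewrite patchE; case: ifPn => //; rewrite notin_setE /= in_itv/= => /negP.
  rewrite negb_and -!ltNge => /orP[s1|s1].
    by rewrite v_lt// (lt_trans s1).
  by rewrite v_gt// (lt_trans h1).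
- move=> x y _ _ xy; have := growth x y (ltW xy); lra.
- by move=> x _; exact: cF'.
- by apply/cvg_ex; exists (F' (- b)); apply: cvg_at_right_filter; exact: cF'.
- by apply/cvg_ex; exists (F' b); apply: cvg_at_left_filter; exact: cF'.
- split; first by move=> x _; have [] := dF x.
    by apply: cvg_at_right_filter; exact: cF.
  by apply: cvg_at_left_filter; exact: cF.
- exact: continuous_subspaceT.
Qed.

(** [g] may depend on the coordinate [i] itself, so volume need not be preserved: the Jacobian
    determinant is 1 + d_i g. *)
Definition shear (R : realType) d (i : 'I_d) (g : 'rV[R]_d -> R) (x : 'rV[R]_d) :=
  rV_upd x i (x ord0 i + g x).

Lemma rV_upd_continuous (R : realType) d (x : 'rV[R]_d) i :
  continuous (rV_upd x i).
Proof.
move=> s; apply: cvg_rV => j; rewrite !mxE.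
rewrite (_ : (fun u => _) = fun u => if j == i then u else x ord0 j).
  by case: ifP => _; [exact: cvg_id|exact: cvg_cst].
by apply/funext => u; rewrite mxE.
Qed.

Lemma shear_continuous (R : realType) d (i : 'I_d) (g : 'rV[R]_d -> R) :
  continuous g -> continuous (shear i g).
Proof.
move=> cg x; apply: (@cvg_rV R d _ (nbhs x) (shear i g) _ (nbhs_filter x)) => j; rewrite !mxE.
rewrite (_ : (fun y => _) = fun y : 'rV[R]_d => if j == i then y ord0 i + g y else y ord0 j).
  case: ifP => _; last exact: coord_continuous.
  by apply: cvgD; [exact: coord_continuous|exact: cg].
by apply/funext => u; rewrite mxE.
Qed.

Lemma is_derive_line (R : realType) d (i : 'I_d) (g g' : 'rV[R]_d -> R) x (s : R) :
  (forall x, is_derive x (delta_mx ord0 i) g (g' x)) ->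
  is_derive s 1 (fun u => g (rV_upd x i u)) (g' (rV_upd x i s)).
Proof.
move=> dg; have [] := dg (rV_upd x i s).
have E : (fun h : R => h^-1 *: ((g \o shift (rV_upd x i s)) (h *: delta_mx ord0 i) - g (rV_upd x i s)))
  = (fun h : R => h^-1 *: (((fun u => g (rV_upd x i u)) \o shift s) (h *: 1) - g (rV_upd x i s))).
  apply/funext => h /=; congr (_ *: (g _ - _)).
  by apply/rowP => j; rewrite !mxE eqxx /= [h%:A]mulr1; case: eqP => _; rewrite ?mulr1 ?mulr0 ?add0r.
rewrite /derivable /derive E => h1 h2.
exact: DeriveDef.
Qed.

Lemma integral_shear (R : realType) d (i : 'I_d) (g g' v : 'rV[R]_d -> R) (r : R) :
  (forall x, is_derive x (delta_mx ord0 i) g (g' x)) ->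
  continuous g -> continuous g' -> (forall x, - 2^-1 <= g' x) ->
  continuous v -> (forall x, 0 <= v x) -> (forall x, r < `|x| -> v x = 0) ->
  (\int[lebesgue_rV R d]_x (v (shear i g x) * (1 + g' x))%:E =
   \int[lebesgue_rV R d]_x (v x)%:E)%E.
Proof.
move=> dg cg cg' g'h cv v0 vr.
have mR (f : 'rV[R]_d -> R) : continuous f -> measurable_fun [set: 'rV[R]_d] (EFin \o f).
  by move=> cf; apply/measurable_EFinP; exact: continuous_measurable_rV.
apply: (@ge0_eq_integral_axis _ _ i) => [||x|x|x].
- apply: (mR (fun x => v (shear i g x) * (1 + g' x))).
  apply: continuous_mulr_fun; last exact: continuous_add1r_fun.
  by move=> z; apply: continuous_comp; [exact: shear_continuous|exact: cv].
- exact: mR.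
- by rewrite lee_fin mulr_ge0//; have := g'h x; lra.
- by rewrite lee_fin.
(* [F] is the shear read on the line through [x] parallel to the axis [i]; the lower bound on [g']
   makes its slope at least 1/2. *)
pose F s := s + g (rV_upd x i s).
have E s : shear i g (rV_upd x i s) = rV_upd x i (F s).
  by apply/rowP => j; rewrite !mxE eqxx; case: eqP.
under eq_integral do rewrite E.
apply: (@integral_substitution_compact_support R F (fun s => 1 + g' (rV_upd x i s))
  (fun s => v (rV_upd x i s)) r).
- by move=> s; apply: is_deriveD; exact: is_derive_line.
- apply: continuous_add1r_fun => s.
  by apply: continuous_comp; [exact: rV_upd_continuous|exact: cg'].
- by move=> s; have := g'h (rV_upd x i s); lra.
- by move=> s; apply: continuous_comp; [exact: rV_upd_continuous|exact: cv].
- move=> s rs; apply: vr; apply: lt_le_trans rs _.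
  by have := mx_norm_coord (rV_upd x i s) i; rewrite mxE eqxx.
Qed.

(** * Volume distortion along the flow *)

Lemma lipschitz_continuous_fun (R : realType) (V W : normedModType R) (C : R) (f : V -> W) :
  (forall x y, `|f x - f y| <= C * `|x - y|) -> continuous f.
Proof.
move=> fC x; apply/cvgrPdist_lt => e e0.
have C0 : 0 < `|C| + 1 by rewrite ltr_wpDl.
near=> y; apply: le_lt_trans (fC _ _) _.
apply: (@le_lt_trans _ _ ((`|C| + 1) * `|x - y|)).
  by rewrite ler_wpM2r//; have := ler_norm C; lra.
rewrite mulrC -ltr_pdivlMr//.
by near: y; apply: cvgr_dist_lt; [exact: cvg_id|rewrite divr_gt0].
Unshelve. all: by end_near. Qed.

Lemma pair_continuous_l (X Y : topologicalType) (y : Y) : continuous (fun x : X => (x, y)).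
Proof. by move=> x; exact: (cvg_pair cvg_id (cvg_cst y)). Qed.

Lemma pair_continuous_r (X Y : topologicalType) (x : X) : continuous (fun y : Y => (x, y)).
Proof. by move=> y; exact: (cvg_pair (cvg_cst x) cvg_id). Qed.

(** The reciprocal of 1 + z is at most 1 - z + 2z^2, hence at most exp(-z + 2z^2). Bounding each
    Jacobian factor below by an exponential turns the product over the shears into a sum. *)
Lemma expR_le1D (R : realType) (z : R) : `|z| <= 2^-1 -> expR (z - 2 * z ^+ 2) <= 1 + z.
Proof.
move=> z1; have [z2 z3] : - 2^-1 <= z /\ z <= 2^-1.
  by move: z1; rewrite ler_norml => /andP[].
have z0 : 0 < 1 + z by lra.
rewrite -[z - _]opprK expRN -[leRHS]invrK lef_pV2 ?posrE ?invr_gt0 ?expR_gt0//.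
apply: le_trans (expR_ge1Dx _).
rewrite -(ler_pM2r z0) mulVf ?gt_eqF//; nra.
Qed.

(** Only the base point is confined to the compact set; the nearby point may leave it, which is why
    [f] is continuous everywhere. *)
Lemma compact_uniform_continuity (R : realType) d (T rho : R) (V : normedModType R)
    (f : 'rV[R]_d * R -> V) (e : R) :
  continuous f -> 0 < e -> exists2 h : R, 0 < h & forall x y s t,
    `|x| <= rho -> s \in `[0, T] -> `|y - x| < h -> `|t - s| < h ->
    `|f (y, t) - f (x, s)| < e.
Proof.
move=> cf e0.
have cK : compact ([set x : 'rV[R]_d | `|x| <= rho] `*` [set` `[0, T]]).
  apply: compact_setX; last exact: segment_compact.
  apply: bounded_closed_compact.
    exists rho; split; first exact: num_real.
    by move=> M rM x /= /le_trans; apply; exact: ltW.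
  rewrite (_ : [set x | _] = (fun x : 'rV[R]_d => `|x|) @^-1` [set r | r <= rho])//.
  by apply: closed_comp; [move=> x _; exact: norm_continuous|exact: closed_le].
pose P (h : R) (p : 'rV[R]_d * R) := forall q : 'rV[R]_d * R,
  `|q.1 - p.1| < h -> `|q.2 - p.2| < h -> `|f q - f p| < e.
have HP : \forall h \near (0 : R)^'+, ([set x : 'rV[R]_d | `|x| <= rho] `*` [set` `[0, T]]) `<=` P h.
  apply: (proj1 (compact_near_coveringP _) cK) => p _.
  have e2 : 0 < e / 2 by lra.
  have /cvgrPdist_lt /(_ _ e2) := cf p; rewrite -nbhs_ballE => -[r /= r0 Hr].
  have r2 : 0 < r / 2 by lra.
  exists (ball p (r / 2), [set h | h < r / 2]) => /=.
    by split; [exact: nbhsx_ballx|exact: nbhs_right_lt].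
  move=> [p' h] /= [pp' hr] q q1 q2.
  have : ball p r p' by apply: le_ball pp'; lra.
  move=> /Hr /= h1.
  have : ball p r q.
    rewrite (splitr r); apply: ball_triangle pp' _.
    split; rewrite -ball_normE /= distrC; apply: lt_trans hr; assumption.
  move=> /Hr /= h2; rewrite -(subrKA (f p)); apply: le_lt_trans (ler_normD _ _) _.
  rewrite distrC; lra.
have [h [h0 H]] : exists h : R, 0 < h /\
    ([set x : 'rV[R]_d | `|x| <= rho] `*` [set` `[0, T]]) `<=` P h.
  near (0 : R)^'+ => h; exists h; split; first by near: h; exact: nbhs_right_gt.
  by near: h; exact: HP.
exists h => // x y s t xr sT yx ts.
exact: (H (x, s) (conj xr sT) (y, t) yx ts).
Unshelve. all: by end_near. Qed.

(** * Splitting a time step into shears *)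

Section splitting.
Context (R : realType) (d : nat) (h : R) (a p : 'I_d -> 'rV[R]_d -> R) (K L : R).
Hypotheses (h0 : 0 <= h) (K0 : 0 < K) (hK : h * K <= 2^-1) (hL : h * L <= 2^-1).
Hypothesis da : forall i x, is_derive x (delta_mx ord0 i) (a i) (p i x).
Hypothesis ca : forall i, continuous (a i).
Hypothesis cp : forall i, continuous (p i).
Hypothesis lip : forall i x y, `|a i x - a i y| <= K * `|x - y|.
Hypothesis pL : forall i x, `|p i x| <= L.

(** An explicit Euler step of length [h] in the coordinate [i] alone, and its Jacobian determinant.
    In [split_step] each shear acts on the point already moved by the preceding ones. *)
Let E i := shear i (fun x => h * a i x).
Let J i x := 1 + h * p i x.

Fixpoint split_step (l : seq 'I_d) x := if l is i :: l' then split_step l' (E i x) else x.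

(* The Jacobian of [split_step l], by the chain rule. *)
Fixpoint split_jac (l : seq 'I_d) x :=
  if l is i :: l' then J i x * split_jac l' (E i x) else 1.

Let hp i x : `|h * p i x| <= 2^-1.
Proof. by apply: le_trans hL; rewrite normrM ger0_norm// ler_wpM2l. Qed.

Let J_ge0 i x : 0 <= J i x.
Proof. by have := hp i x; rewrite ler_norml /J => /andP[? _]; lra. Qed.

Let E_dist i x : `|E i x - x| <= h * `|a i x|.
Proof.
apply: mx_norm_le => [|j]; first by rewrite mulr_ge0.
rewrite !mxE; case: eqP => [->|_]; last by rewrite subrr normr0 mulr_ge0.
by rewrite addrAC subrr add0r normrM ger0_norm.
Qed.

Let cE i : continuous (E i).
Proof.
apply: shear_continuous; apply: continuous_mulr_fun => //.
exact: cst_continuous.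
Qed.

Let cJ i : continuous (J i).
Proof.
apply: continuous_add1r_fun; apply: continuous_mulr_fun => //.
exact: cst_continuous.
Qed.

Lemma split_step_continuous l : continuous (split_step l).
Proof.
elim: l => [|i l IH] x /=; first exact: cvg_id.
by apply: (@continuous_comp _ _ _ (E i) (split_step l)); [exact: cE|exact: IH].
Qed.

Lemma split_jac_continuous l : continuous (split_jac l).
Proof.
elim: l => [|i l IH] /=; first exact: cst_continuous.
apply: continuous_mulr_fun => // x.
by apply: (@continuous_comp _ _ _ (E i) (split_jac l)); [exact: cE|exact: IH].
Qed.

Lemma split_jac_ge0 l x : 0 <= split_jac l x.
Proof. by elim: l x => [|i l IH] x //=; rewrite mulr_ge0. Qed.

Lemma integral_split_step l (u : 'rV[R]_d -> R) (r : R) :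
  continuous u -> (forall x, 0 <= u x) -> (forall x, r < `|x| -> u x = 0) ->
  (\int[lebesgue_rV R d]_x (u (split_step l x) * split_jac l x)%:E =
   \int[lebesgue_rV R d]_x (u x)%:E)%E.
Proof.
move=> cu u0 ur.
(* [integral_shear] needs a compactly supported integrand at each stage, so a support radius is
   carried through the induction. *)
suff : (exists r', forall x, r' < `|x| -> u (split_step l x) = 0) /\
   (\int[lebesgue_rV R d]_x (u (split_step l x) * split_jac l x)%:E =
   \int[lebesgue_rV R d]_x (u x)%:E)%E by case.
elim: l => [|i l [[r' IHr] IHi]] /=.
  by split; [exists r|under eq_integral do rewrite mulr1].
split.
  (* With [h * K <= 2^-1], a shear moves x by at most h|a_i 0| + |x|/2, so |E i x| >= |x|/2 - h|a_i
     0|; this exceeds |r'| outside the chosen radius. *)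
  exists (2 * (`|r'| + h * `|a i 0|)) => x xr; rewrite IHr//.
  have h1 : `|a i x| <= `|a i 0| + K * `|x|.
    by have := lip i x 0; rewrite subr0; have := lerB_dist (a i x) (a i 0); lra.
  have h2 := E_dist i x.
  have h3 : `|x| - `|E i x| <= `|E i x - x| by rewrite distrC; exact: lerB_dist.
  have h4 : h * `|a i x| <= h * `|a i 0| + h * K * `|x|.
    by rewrite -mulrA -mulrDr ler_wpM2l.
  have h5 : h * K * `|x| <= 2^-1 * `|x| by rewrite ler_wpM2r.
  have := ler_norm r'; lra.
pose v x := u (split_step l x) * split_jac l x.
have vE x : u (split_step l (E i x)) * (J i x * split_jac l (E i x)) = v (E i x) * J i x.
  by rewrite /v; ring.
under eq_integral do rewrite vE.
rewrite -IHi; apply: (@integral_shear _ _ i (fun x => h * a i x) (fun x => h * p i x) v r').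
- by apply: continuous_mulr_fun => //; exact: cst_continuous.
- by apply: continuous_mulr_fun => //; exact: cst_continuous.
- by move=> x; have := hp i x; rewrite ler_norml => /andP[].
- apply: continuous_mulr_fun; last exact: split_jac_continuous.
  by move=> x; apply: continuous_comp; [exact: split_step_continuous|exact: cu].
- by move=> x; rewrite mulr_ge0// split_jac_ge0.
- by move=> x xr; rewrite /v IHr// mul0r.
Qed.

(** An arbitrary list of axes is allowed for the sake of induction; in the enumeration of all axes
    each [count_mem] is 1. In the exponent, [e] accounts for the variation of the partial
    derivatives and the square for the loss in [expR_le1D]. *)
Lemma split_step_estimate (x : 'rV[R]_d) (e c B : R) l : 0 <= B ->
  (forall i y, `|y - x| <= c -> [/\ `|a i y| <= B, `|a i y - a i x| <= e & `|p i y - p i x| <= e]) ->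
  h * B * (size l)%:R <= c ->
  (forall j, `|split_step l x ord0 j - x ord0 j - h * (count_mem j l)%:R * a j x|
     <= h * e * (count_mem j l)%:R) /\
  expR (\sum_(i <- l) (h * (p i x - e) - 2 * (h * L) ^+ 2)) <= split_jac l x.
Proof.
move=> B0 H hc.
(* The reference point [x] stays fixed while the start [y] moves: [b] is the distance already
   travelled, and each remaining shear adds at most [h * B]. *)
suff G b y : `|y - x| <= b -> b + h * B * (size l)%:R <= c ->
   (forall j, `|split_step l y ord0 j - y ord0 j - h * (count_mem j l)%:R * a j x|
     <= h * e * (count_mem j l)%:R) /\
  expR (\sum_(i <- l) (h * (p i x - e) - 2 * (h * L) ^+ 2)) <= split_jac l y.
  by apply: (G 0); rewrite ?subrr ?normr0// add0r.
elim: l b y {hc} => [|i l IH] b y yb hc /=.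
  split=> [j|]; last by rewrite big_nil expR0.
  by rewrite subrr !mulr0 mul0r subr0 normr0.
have hB0 : 0 <= h * B by rewrite mulr_ge0.
have hBl : 0 <= h * B * (size l)%:R by rewrite mulr_ge0.
have {}hc : b + h * B + h * B * (size l)%:R <= c.
  by move: hc; rewrite /= mulrS mulrDr mulr1 addrA.
have yc : `|y - x| <= c by lra.
have [aB aE pE] := H i y yc.
have [||IH1 IH2] := IH (b + h * B) (E i y); [|lra|].
  rewrite -(subrKA y); apply: le_trans (ler_normD _ _) _.
  have := E_dist i y; have : h * `|a i y| <= h * B by rewrite ler_wpM2l.
  lra.
split.
  move=> j; rewrite natrD.
  have -> : split_step l (E i y) ord0 j - y ord0 j - h * ((i == j)%:R + (count_mem j l)%:R) * a j x
    = (split_step l (E i y) ord0 j - E i y ord0 j - h * (count_mem j l)%:R * a j x)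
      + (E i y ord0 j - y ord0 j - h * (i == j)%:R * a j x) by ring.
  apply: le_trans (ler_normD _ _) _; rewrite mulrDr [leRHS]addrC; apply: lerD; first exact: IH1.
  rewrite !mxE eq_sym; case: (eqVneq i j) => [<-|_]; last first.
    by rewrite !mulr0 mul0r subr0 subrr normr0.
  have -> : y ord0 i + h * a i y - y ord0 i - h * true%:R * a i x = h * (a i y - a i x).
    by rewrite /=; ring.
  by rewrite mulr1 normrM ger0_norm// ler_wpM2l.
rewrite big_cons expRD; apply: ler_pM; rewrite ?expR_ge0//.
apply: le_trans (expR_le1D (hp i y)); rewrite ler_expR; apply: lerB.
  rewrite ler_wpM2l//; move: pE; rewrite ler_norml => /andP[]; lra.
rewrite ler_wpM2l// -[(h * p i y) ^+ 2]real_normK ?num_real//.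
apply: lerXn2r; rewrite ?nnegrE ?normr_ge0//.
  by rewrite mulr_ge0//; apply: le_trans (normr_ge0 _) (pL i y).
by rewrite normrM ger0_norm// ler_wpM2l.
Qed.

End splitting.

Section volume.
Context (R : realType) (d : nat) (T K L M : R) (A : 'rV[R]_d -> R -> 'rV[R]_d)
  (p : 'I_d -> 'rV[R]_d -> R -> R).
Hypotheses (T0 : 0 <= T) (K0 : 0 < K) (L0 : 0 < L) (M0 : 0 <= M).
Hypothesis Acont : continuous (fun q : 'rV[R]_d * R => A q.1 (clamp T q.2)).
Hypothesis Alip : forall x y t, t \in `[0, T] -> `|A x t - A y t| <= K * `|x - y|.
Hypothesis dA : forall i x t, t \in `[0, T] ->
  is_derive x (delta_mx ord0 i) (fun y => A y t ord0 i) (p i x t).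
Hypothesis pcont : forall i, continuous (fun q : 'rV[R]_d * R => p i q.1 (clamp T q.2)).
Hypothesis pL : forall i x t, t \in `[0, T] -> `|p i x t| <= L.
Hypothesis pM : forall x t, t \in `[0, T] -> - M <= \sum_i p i x t.

Notation D := (flow A T).
Notation mu := (lebesgue_rV R d).

Lemma fixed_time_continuous (V : topologicalType) (f : 'rV[R]_d -> R -> V) t : t \in `[0, T] ->
  continuous (fun q : 'rV[R]_d * R => f q.1 (clamp T q.2)) -> continuous (f ^~ t).
Proof.
move=> tT cf x.
have := @continuous_comp _ _ _ (fun y : 'rV[R]_d => (y, t))
  (fun q : 'rV[R]_d * R => f q.1 (clamp T q.2)) x (@pair_continuous_l _ _ t x) (cf _).
by rewrite /comp /= clamp_id.
Qed.

Lemma field_bounded : exists a0 : R, 0 <= a0 /\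
  forall x t, t \in `[0, T] -> `|A x t| <= a0 + K * `|x|.
Proof.
have c0 : continuous (fun t => A 0 (clamp T t)).
  move=> t; apply: (@continuous_comp _ _ _ (fun s : R => ((0 : 'rV[R]_d), s))
    (fun q : 'rV[R]_d * R => A q.1 (clamp T q.2))); first exact: pair_continuous_r.
  exact: Acont.
have [|c cT hc] := @EVT_max R (fun t => `|A 0 (clamp T t)|) 0 T T0.
  by apply: continuous_subspaceT => t; apply: cvg_norm; exact: c0.
exists `|A 0 (clamp T c)|; split => // x t tT.
have := hc t tT; rewrite (clamp_id tT); have := Alip x 0 tT; rewrite subr0.
by have := lerB_dist (A x t) (A 0 t); lra.
Qed.

(* On the ball of radius [rho] the flow over a time [h] is [h * e]-close to
   [split_step], whose change of variables is exact by [integral_split_step];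
   off that ball [u] vanishes along the flow. *)
Lemma one_step_volume (r : R) : 0 <= r -> exists2 rho : R, 0 <= rho &
  forall e, 0 < e -> exists2 h0, 0 < h0 &
  forall s h, 0 <= h -> h <= h0 -> s \in `[0, T] -> s + h \in `[0, T] ->
  forall (u : 'rV[R]_d -> R) (Lu : R), 0 <= Lu -> (forall x, 0 <= u x) ->
   (forall x y, `|u x - u y| <= Lu * `|x - y|) -> (forall x, r < `|x| -> u x = 0) ->
   (\int[mu]_x (u (D s (s + h) x))%:E <=
     (expR (h * (M + e)))%:E * \int[mu]_x (u x)%:E +
      (Lu * h * e)%:E * mu [set x | (`|x| <= rho)%R])%E.
Proof.
move=> r0.
have half (z : R) : 0 < z -> z / 2 < z by move=> z0; rewrite gtr_pMr// invf_lt1// ltr1n.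
have jac_arith (h e e1 z x y : R) : h * (- M) <= h * z -> x <= h * (e / 4) ->
    y <= h * e1 -> h * e1 <= h * (e / 4) -> 0 <= h * e -> - (h * (M + e)) <= h * z - x - y.
  by lra.
have step_arith (h e e1 x y : R) : x <= h * (2 * e1) -> y <= h * e1 ->
    h * e1 <= h * (e / 4) -> 0 <= h * e -> x + y <= h * e.
  by lra.
have [C [C0 DC]] := flow_bounded T0 K0 Acont Alip.
have [a0 [a00 Ab]] := field_bounded.
(* Points that the flow sends into the ball of radius [r] come from the ball of radius [rho], by the
   growth bound for the reversed flow. *)
pose rho := C * (1 + r).
have rho0 : 0 <= rho by rewrite mulr_ge0// addr_ge0.
exists rho => // e e0.
(* A common speed bound: the second term covers the true trajectories from the ball of radius [rho],
   the third the points of norm at most [rho + 1] visited by the splitting. *)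
pose B := a0 + K * (C * (1 + (rho + 1))) + K * (rho + 1).
have B0 : 0 <= B.
  by rewrite /B !addr_ge0// mulr_ge0 ?(ltW K0)// ?mulr_ge0// !addr_ge0.
(* [d.+1] instead of [d] makes the divisor at least 1; then [d] errors of size [e1] add up to at
   most e/4. *)
pose dd : R := d.+1%:R.
have dd0 : 1 <= dd by rewrite ler1n.
have dd00 : 0 <= dd by exact: le_trans ler01 dd0.
have d4 : 0 < 4 * dd by rewrite mulr_gt0// (lt_le_trans ltr01).
pose e1 := e / (4 * dd).
have e10 : 0 < e1 by rewrite divr_gt0.
have e1d : dd * e1 = e / 4.
  by rewrite /e1; field; rewrite gt_eqF// (lt_le_trans ltr01).
have e1e : e1 <= e / 4 by rewrite -e1d ler_peMl// ltW.
have [hA hA0 HA] := compact_uniform_continuity T (rho + 1) Acont e10.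
pose pv x t : 'rV[R]_d := \row_i p i x t.
have cpv : continuous (fun q : 'rV[R]_d * R => pv q.1 (clamp T q.2)).
  move=> q; apply: (@cvg_rV _ _ _ (nbhs q) _ _ _) => i; rewrite mxE.
  rewrite (_ : (fun y => _) = fun q : 'rV[R]_d * R => p i q.1 (clamp T q.2)).
    exact: pcont.
  by apply/funext => y; rewrite mxE.
have [hp hp0 Hp] := compact_uniform_continuity T (rho + 1) cpv e10.
(* [k] is the tolerance for displacements and elapsed times. [Q] below collects the rates occurring
   in the estimates, so that [h <= k / Q] makes [h] times each of them at most [k]. *)
pose k := Num.min 2^-1 (Num.min (hA / 2) (Num.min (hp / 2) (Num.min e1 (e1 / K)))).
have k0 : 0 < k.
  by rewrite !lt_min e10 !divr_gt0// invr_gt0 ltr0n.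
have : k <= k by [].
rewrite {2}/k !le_min => /and5P[k2 kA kp ke1 kK].
have {}kK : K * k <= e1 by rewrite mulrC -ler_pdivlMr.
pose Q := Num.max 1 (Num.max K (Num.max L (Num.max (B * dd) (Num.max (K * B) (2 * dd * L ^+ 2))))).
have Q0 : 0 < Q by rewrite lt_max ltr01.
exists (k / Q); first by rewrite divr_gt0.
move=> s h h0 hh0 sT shT u Lu Lu0 u0 uL ur.
have hQ : h * Q <= k by rewrite -ler_pdivlMr.
have part X : X <= Q -> h * X <= k by move=> XQ; apply: le_trans hQ; rewrite ler_wpM2l.
have hk : h <= k by rewrite -[h]mulr1; apply: part; rewrite /Q !le_max lexx ?orbT.
have hK : h * K <= k by apply: part; rewrite /Q !le_max lexx ?orbT.
have hL : h * L <= k by apply: part; rewrite /Q !le_max lexx ?orbT.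
have hBd : h * (B * dd) <= k by apply: part; rewrite /Q !le_max lexx ?orbT.
have hKB : h * (K * B) <= k by apply: part; rewrite /Q !le_max lexx ?orbT.
have hLL : h * (2 * dd * L ^+ 2) <= k by apply: part; rewrite /Q !le_max lexx ?orbT.
pose a i (x : 'rV[R]_d) := A x s ord0 i.
pose ps i x := p i x s.
have ca i : continuous (a i).
  have cA := fixed_time_continuous sT Acont.
  move=> x; exact: (continuous_cvg _ (@coord_continuous R 1 d ord0 i (A x s)) (cA x)).
have cps i : continuous (ps i) by exact: fixed_time_continuous sT (pcont (i := i)).
have da i x : is_derive x (delta_mx ord0 i) (a i) (ps i x) by exact: dA.
have lip i x y : `|a i x - a i y| <= K * `|x - y|.
  apply: le_trans (Alip _ _ sT); have := mx_norm_coord (A x s - A y s) i.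
  by rewrite !mxE.
have psL i x : `|ps i x| <= L by exact: pL.
have hK2 : h * K <= 2^-1 by exact: le_trans hK k2.
have hL2 : h * L <= 2^-1 by exact: le_trans hL k2.
pose l := enum 'I_d.
pose S := split_step h a l; pose J := split_jac h a ps l.
have cS : continuous S by exact: split_step_continuous.
have cJ : continuous J by exact: split_jac_continuous.
have J0 x : 0 <= J x by exact: (split_jac_ge0 _ h0 hL2 psL).
have cu : continuous u by exact: lipschitz_continuous_fun uL.
have main x : `|x| <= rho -> `|u (D s (s + h) x) - u (S x)| <= Lu * h * e /\
   expR (- (h * (M + e))) <= J x.
  move=> xr; have xr1 : `|x| <= rho + 1 by apply: le_trans xr _; rewrite lerDl.
  have inball y : `|y - x| <= k -> `|y| <= rho + 1.
    move=> yx; rewrite -(subrK x y) [rho + 1]addrC; apply: le_trans (ler_normD _ _) _.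
    by rewrite lerD// (le_trans yx)// (le_trans k2)// invf_le1// ler1n.
  have [||S1 S2] := @split_step_estimate R d h a ps L h0 hL2 psL x e1 k B l B0.
  - move=> i y yx; split.
    + apply: le_trans (mx_norm_coord _ _) _; apply: le_trans (Ab _ _ sT) _.
      have : K * `|y| <= K * (rho + 1) by rewrite ler_wpM2l ?(ltW K0)// inball.
      have : 0 <= K * (C * (1 + (rho + 1))).
        by rewrite mulr_ge0 ?(ltW K0)// mulr_ge0// !addr_ge0.
      by move=> ? ?; rewrite /B -addrA lerD2l; exact: ler_wpDl.
    + apply: le_trans (lip _ _ _) _; apply: le_trans kK.
      by rewrite ler_wpM2l// ltW.
    + have := Hp x y s s xr1 sT; rewrite subrr normr0 !clamp_id// => /(_ _ hp0) H.
      apply: ltW; apply: le_lt_trans (H _); last exact: le_lt_trans (le_trans yx kp) (half _ hp0).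
      by have := mx_norm_coord (pv y s - pv x s) i; rewrite !mxE.
  - rewrite size_enum_ord -mulrA; apply: le_trans hBd.
    by rewrite ler_wpM2l// ler_wpM2l// ler_nat.
  split; last first.
    (* Budget for the exponent: the divergence costs at most h M, the variation of the partial
       derivatives h e/4, and the quadratic terms h e1 <= h e/4. *)
    apply: le_trans S2; rewrite ler_expR big_enum /= sumrB -mulr_sumr sumrB !sumr_const card_ord.
    have := pM x sT; rewrite -/(ps _ _) => hM.
    have h1 : h * (- M) <= h * (\sum_i ps i x) by rewrite ler_wpM2l.
    have dle : d%:R <= dd by rewrite ler_nat.
    have h2 : h * (e1 *+ d) <= h * (e / 4).
      by rewrite ler_wpM2l// -e1d -mulr_natl ler_wpM2r// ltW.
    have h3 : (2 * (h * L) ^+ 2) *+ d <= h * e1.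
      rewrite -mulr_natl; apply: (@le_trans _ _ (h * (h * (2 * dd * L ^+ 2)))); last first.
        by rewrite ler_wpM2l//; apply: le_trans ke1.
      have -> : h * (h * (2 * dd * L ^+ 2)) = dd * (2 * (h * L) ^+ 2) by ring.
      by rewrite ler_wpM2r// mulr_ge0// exprn_ge0// mulr_ge0// ltW.
    have h4 : h * e1 <= h * (e / 4) by rewrite ler_wpM2l.
    have h5 : 0 <= h * e by rewrite mulr_ge0// ltW.
    by rewrite mulrBr; exact: jac_arith h1 h2 h3 h4 h5.
  apply: le_trans (uL _ _) _; rewrite -mulrA ler_wpM2l//.
  apply: mx_norm_le => [|j]; first by rewrite mulr_ge0// ltW.
  have := S1 j; rewrite -/(S x) count_uniq_mem ?enum_uniq// mem_enum /= !mulr1 => S1j.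
  have ssh : s <= s + h by rewrite lerDl.
  have sub (z y : R) : z \in `[0, T] -> y \in `[s, z] -> y \in `[0, T].
    move: sT; rewrite !in_itv/= => /andP[s1 s2] /andP[z1 z2] /andP[y1 y2].
    by rewrite (le_trans s1 y1) (le_trans y2 z2).
  have speed y : y \in `[0, T] -> `|A (D s y x) y| <= B.
    move=> yT; apply: le_trans (Ab _ _ yT) _.
    have : K * `|D s y x| <= K * (C * (1 + (rho + 1))).
      rewrite ler_wpM2l ?(ltW K0)//; apply: le_trans (DC _ _ _ sT yT) _.
      by rewrite ler_wpM2l// lerD2l.
    have : 0 <= K * (rho + 1) by rewrite mulr_ge0 ?(ltW K0)// addr_ge0.
    by move=> ? ?; rewrite /B; apply: ler_wpDr => //; rewrite lerD2l.
  have [c csh Ec] := flow_increment T0 K0 Acont Alip x j sT shT ssh.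
  have cT := sub _ _ shT csh.
  have /andP[sc ch] : s <= c <= s + h by move: csh; rewrite in_itv.
  have Dx : `|D s c x - x| <= h * B.
    apply: mx_norm_le => [|i]; first by rewrite mulr_ge0.
    have [c' sc' Ec'] := flow_increment T0 K0 Acont Alip x i sT cT sc.
    rewrite !mxE Ec' normrM mulrC [`|c - s|]ger0_norm ?subr_ge0//.
    apply: ler_pM => //; first by rewrite subr_ge0.
      by rewrite lerBlDl.
    by apply: le_trans (mx_norm_coord _ _) _; apply: speed; exact: sub sc'.
  (* One [e1] pays for the motion of the point up to time [c], the other for the change of time in
     the field; the splitting itself costs a third, and 3 e1 <= e. *)
  have Ax : `|A (D s c x) c ord0 j - a j x| <= 2 * e1.
    rewrite /a -(subrKA (A x c ord0 j)); apply: le_trans (ler_normD _ _) _.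
    have t1 : `|A (D s c x) c ord0 j - A x c ord0 j| <= e1.
      have := mx_norm_coord (A (D s c x) c - A x c) j; rewrite !mxE => t1.
      apply: le_trans t1 _; apply: le_trans (Alip _ _ cT) _.
      apply: (@le_trans _ _ (h * (K * B))); last by apply: le_trans ke1.
      by rewrite mulrCA ler_wpM2l// ltW.
    have t2 : `|A x c ord0 j - A x s ord0 j| <= e1.
      have := mx_norm_coord (A x c - A x s) j; rewrite !mxE => t2.
      apply: le_trans t2 _; have := HA x x s c xr1 sT; rewrite subrr normr0 => /(_ hA0).
      rewrite !clamp_id//= => t3; apply: ltW; apply: t3.
      rewrite ger0_norm ?subr_ge0//; apply: le_lt_trans (half _ hA0).
      by apply: le_trans kA; apply: le_trans hk; rewrite lerBlDl.
    by rewrite mulr_natl mulr2n; exact: lerD.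
  rewrite !mxE; have -> : D s (s + h) x ord0 j - S x ord0 j =
    h * (A (D s c x) c ord0 j - a j x) - (S x ord0 j - x ord0 j - h * a j x).
    have : D s (s + h) x ord0 j = x ord0 j + h * A (D s c x) c ord0 j.
      have -> : h * A (D s c x) c ord0 j = A (D s c x) c ord0 j * (s + h - s) by ring.
      by rewrite -Ec; ring.
    by move=> ->; ring.
  apply: le_trans (ler_normB _ _) _; rewrite normrM ger0_norm//.
  apply: (step_arith h e e1) => //.
  - by rewrite ler_wpM2l.
  - by rewrite ler_wpM2l.
  - by rewrite mulr_ge0// ltW.
have out x : rho < `|x| -> u (D s (s + h) x) = 0.
  move=> xr; apply: ur; rewrite ltNge; apply/negP => H.
  have := DC (s + h) s (D s (s + h) x) shT sT.
  rewrite (flowK T0 K0 Acont Alip)// => H'.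
  have : C * (1 + `|D s (s + h) x|) <= rho by rewrite /rho ler_wpM2l// lerD2l.
  by move=> /(le_trans H'); rewrite leNgt xr.
have mR (f : 'rV[R]_d -> R) : continuous f -> measurable_fun [set: 'rV[R]_d] (EFin \o f).
  by move=> cf; apply/measurable_EFinP; exact: continuous_measurable_rV.
have cD : continuous (D s (s + h)).
  apply: lipschitz_continuous_fun => x y.
  exact: (flow_lipschitz T0 K0 Acont Alip x y sT shT).
have cuS : continuous (fun x => u (S x) * J x).
  apply: continuous_mulr_fun => // x.
  by apply: continuous_comp; [exact: cS|exact: cu].
have mball := @measurable_rV_cube0 R d rho rho0.
(* On the ball expR(h(M + e)) J >= 1, so inserting this factor only increases u(S x). The indicator
   confines the additive error to a set of finite measure. *)
pose F (x : 'rV[R]_d) : \bar R := ((expR (h * (M + e)))%:E * (u (S x) * J x)%:E +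
   (Lu * h * e)%:E * (\1_[set x : 'rV[R]_d | (`|x| <= rho)%R] x)%:E)%E.
have Lhe : 0 <= Lu * h * e by rewrite mulr_ge0 ?(ltW e0)// mulr_ge0.
have uSJ x : 0 <= u (S x) * J x by rewrite mulr_ge0.
apply: (@le_trans _ _ (\int[mu]_x F x)%E).
  apply: ge0_le_integral => //.
  - by move=> x _; rewrite lee_fin.
  - apply: mR => x; apply: continuous_comp; [exact: cD|exact: cu].
  - apply: emeasurable_funD.
      by apply: measurable_funeM; exact: mR.
    apply: measurable_funeM; apply/measurable_EFinP; exact: measurable_indic.
  - move=> x _; rewrite /F -!EFinM -EFinD lee_fin indicE.
    have [xr|xr] := leP `|x| rho.
      rewrite mem_set// mulr1; have [m1 m2] := main x xr.
      have : u (S x) <= expR (h * (M + e)) * (u (S x) * J x).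
        rewrite mulrCA ler_peMr// -(ler_pM2l (expR_gt0 (- (h * (M + e))))) mulr1 mulrA.
        by rewrite -expRD addNr expR0 mul1r.
      by move: m1; rewrite ler_norml lerBlDl => /andP[_ /le_trans m1] ?; apply: m1; rewrite lerD2r.
    by rewrite out// addr_ge0// mulr_ge0// expR_ge0.
rewrite /F ge0_integralD//; last first.
- by apply: measurable_funeM; apply/measurable_EFinP; exact: measurable_indic.
- by move=> x _; rewrite -EFinM lee_fin mulr_ge0.
- by apply: measurable_funeM; exact: mR.
- by move=> x _; rewrite -EFinM lee_fin mulr_ge0// expR_ge0.
rewrite !ge0_integralZl_EFin//; last first.
- exact: mR.
- by move=> x _; rewrite lee_fin.
- by apply/measurable_EFinP; exact: measurable_indic.
rewrite integral_indic// setIT.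
by rewrite (integral_split_step h0 hK2 hL2 da ca cps lip psL l cu u0 ur).
Qed.

(** [a, b] is cut into equal steps, and the one-step bound is applied to [f o D_{s -> b}], whose
    Lipschitz constant [W * Lf] and support radius [C * (1 + r)] do not depend on s. The step errors
    add up to a multiple of [e], which then tends to 0. *)
Lemma flow_volume_lipschitz a b (f : 'rV[R]_d -> R) (Lf r : R) :
  a \in `[0, T] -> b \in `[0, T] -> a <= b -> 0 <= Lf -> 0 <= r ->
  (forall x, 0 <= f x) -> (forall x y, `|f x - f y| <= Lf * `|x - y|) ->
  (forall x, r < `|x| -> f x = 0) ->
  (\int[mu]_x (f (D a b x))%:E <= (expR (M * (b - a)))%:E * \int[mu]_x (f x)%:E)%E.
Proof.
move=> aT bT ab Lf0 r0 f0 fL fr.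
have [C [C0 DC]] := flow_bounded T0 K0 Acont Alip.
pose W := 2 * expR (2 * K * T).
have W0 : 0 <= W by rewrite mulr_ge0// expR_ge0.
have r'0 : 0 <= C * (1 + r) by rewrite mulr_ge0// addr_ge0.
have [rho rho0 Hrho] := one_step_volume r'0.
have mball := @measurable_rV_cube0 R d.
have fball z : (mu [set x : 'rV[R]_d | (`|x| <= z)%R] \is a fin_num)%E.
  by rewrite ge0_fin_numE//; exact: lebesgue_rV_cube_lty.
set V := fine (mu [set x : 'rV[R]_d | (`|x| <= rho)%R]).
have VE : mu [set x : 'rV[R]_d | (`|x| <= rho)%R] = V%:E by rewrite fineK.
have V0 : 0 <= V by rewrite fine_ge0.
have cf : continuous f by exact: lipschitz_continuous_fun fL.
have fin_f : (\int[mu]_x (f x)%:E \is a fin_num)%E.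
  rewrite ge0_fin_numE; last by apply: integral_ge0 => x _; rewrite lee_fin.
  apply: (@le_lt_trans _ _ (\int[mu]_x ((f 0 + Lf * r)%:E *
      (\1_[set x : 'rV[R]_d | (`|x| <= r)%R] x)%:E))%E).
    apply: ge0_le_integral => //.
    - by move=> x _; rewrite lee_fin.
    - by apply/measurable_EFinP; exact: continuous_measurable_rV.
    - apply: measurable_funeM; apply/measurable_EFinP.
      by apply: measurable_indic; exact: mball.
    - move=> x _; rewrite -EFinM lee_fin indicE; have [xr|xr] := leP `|x| r.
        rewrite mem_set// mulr1; have := fL x 0; rewrite subr0 ler_norml => /andP[_].
        have : Lf * `|x| <= Lf * r by rewrite ler_wpM2l.
        lra.
      by rewrite fr// mulr_ge0// addr_ge0// mulr_ge0.
  rewrite ge0_integralZl_EFin//; last 2 first.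
  - by apply/measurable_EFinP; apply: measurable_indic; exact: mball.
  - by rewrite addr_ge0// mulr_ge0.
  rewrite integral_indic ?setIT//; last exact: mball.
  apply: lte_mul_pinfty => //; last exact: lebesgue_rV_cube_lty.
  by rewrite lee_fin addr_ge0// mulr_ge0.
set I := fine (\int[mu]_x (f x)%:E).
have IE : (\int[mu]_x (f x)%:E = I%:E)%E by rewrite fineK.
have I0 : 0 <= I by rewrite fine_ge0// integral_ge0// => x _; rewrite lee_fin.
have key e : 0 < e -> (\int[mu]_x (f (D a b x))%:E <=
    (expR ((b - a) * (M + e)) * (I + (b - a) * (W * Lf) * e * V))%:E)%E.
  move=> e0; have [h0 h00 Hh] := Hrho e e0.
  have ba : 0 <= b - a by rewrite subr_ge0.
  (* The [+ 1] keeps the denominator positive when a = b. *)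
  have [|n hn] := @natSinv_lt R (h0 / (b - a + 1)); first by rewrite divr_gt0// ltr_wpDl.
  pose h := (b - a) / n.+1%:R.
  have hh : 0 <= h by rewrite divr_ge0.
  have hh0 : h <= h0.
    apply: (@le_trans _ _ ((b - a) * (h0 / (b - a + 1)))).
      by rewrite ler_wpM2l// ltW.
    by rewrite mulrCA ger_pMr// ler_pdivrMr ?ltr_wpDl// mul1r lerDl.
  have nh : n.+1%:R * h = b - a by rewrite /h mulrC divfK// pnatr_eq0.
  have Me0 : 0 <= M + e by rewrite addr_ge0// ltW.
  (* The induction runs backwards from [b]: a step inserted before the time b - j h composes on the
     right with the map already treated. *)
  have ind j : (j <= n.+1)%N -> (\int[mu]_x (f (D (b - j%:R * h) b x))%:E <=
      (expR (j%:R * h * (M + e)) * (I + j%:R * h * (W * Lf) * e * V))%:E)%E.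
    elim: j => [|j IH] jn.
      rewrite !mul0r subr0 expR0 mul1r addr0 -IE.
      by under eq_integral do rewrite (flow_id T0 K0 Acont Alip)//.
    have jT (i : nat) : (i <= n.+1)%N -> b - i%:R * h \in `[0, T].
      move=> i_n; have : i%:R * h <= n.+1%:R * h by rewrite ler_wpM2r// ler_nat.
      have : 0 <= i%:R * h by rewrite mulr_ge0.
      rewrite nh; move: aT bT; rewrite !in_itv/= => /andP[a_ge0 _] /andP[_ bT'] ih0 ih.
      rewrite subr_ge0 (le_trans ih) ?gerBl//=.
      by apply: le_trans bT'; rewrite gerBl.
    have sh : b - j.+1%:R * h + h = b - j%:R * h by rewrite mulrS; ring.
    have sT := jT _ jn; have shT := jT _ (ltnW jn).
    pose u x := f (D (b - j%:R * h) b x).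
    have Lu0 : 0 <= W * Lf by rewrite mulr_ge0.
    have shT' : b - j.+1%:R * h + h \in `[0, T] by rewrite sh.
    have uL x y : `|u x - u y| <= W * Lf * `|x - y|.
      apply: le_trans (fL _ _) _; rewrite (mulrC W) -mulrA ler_wpM2l//.
      exact: (flow_lipschitz T0 K0 Acont Alip).
    have ur x : C * (1 + r) < `|x| -> u x = 0.
      move=> xr; apply: fr; rewrite ltNge; apply/negP => H.
      have := DC b (b - j%:R * h) (D (b - j%:R * h) b x) bT shT.
      rewrite (flowK T0 K0 Acont Alip)// => H'.
      have : C * (1 + `|D (b - j%:R * h) b x|) <= C * (1 + r) by rewrite ler_wpM2l// lerD2l.
      by move=> /(le_trans H'); rewrite leNgt xr.
    have := Hh _ h hh hh0 sT shT' u (W * Lf) Lu0 (fun x => f0 _) uL ur.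
    rewrite sh VE.
    under eq_integral do rewrite /u (flow_comp T0 K0 Acont Alip)//.
    move=> H; apply: le_trans H _.
    apply: (@le_trans _ _ ((expR (h * (M + e)))%:E *
       (expR (j%:R * h * (M + e)) * (I + j%:R * h * (W * Lf) * e * V))%:E +
       (W * Lf * h * e)%:E * V%:E)%E).
      apply: leeD => //; apply: lee_wpmul2l; first by rewrite lee_fin expR_ge0.
      exact: IH (ltnW jn).
    rewrite -!EFinM -EFinD lee_fin mulrA -expRD.
    have -> : h * (M + e) + j%:R * h * (M + e) = j.+1%:R * h * (M + e) by rewrite mulrS; ring.
    (* The error of the current step carries no exponential; it is enlarged by one so that the bound
       keeps its product form. *)
    have E1 : 1 <= expR (j.+1%:R * h * (M + e)).
      by rewrite -expR0 ler_expR mulr_ge0// mulr_ge0.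
    have p0 : 0 <= h * (W * Lf) * e * V.
      by rewrite mulr_ge0// mulr_ge0 ?(ltW e0)// mulr_ge0.
    have -> : j.+1%:R * h * (W * Lf) * e * V = j%:R * h * (W * Lf) * e * V + h * (W * Lf) * e * V.
      by rewrite mulrS; ring.
    rewrite addrA [leRHS]mulrDr lerD2l.
    have -> : W * Lf * h * e * V = h * (W * Lf) * e * V by ring.
    by rewrite ler_peMl.
  have := ind n.+1 (leqnn _); rewrite nh.
  by have -> : b - (b - a) = a by ring.
pose phi e := expR ((b - a) * (M + e)) * (I + (b - a) * (W * Lf) * e * V).
have cphi : continuous phi.
  apply: continuous_mulr_fun => x.
    apply: (@continuous_comp _ _ _ (fun e => (b - a) * (M + e)) expR); last exact: continuous_expR.
    by apply: cvgM; [exact: cvg_cst|apply: cvgD; [exact: cvg_cst|exact: cvg_id]].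
  apply: cvgD; first exact: cvg_cst.
  apply: cvgM; last exact: cvg_cst.
  by apply: cvgM; [exact: cvg_cst|exact: cvg_id].
have fin_D : (\int[mu]_x (f (D a b x))%:E \is a fin_num)%E.
  rewrite ge0_fin_numE; last by apply: integral_ge0 => x _; rewrite lee_fin.
  by apply: le_lt_trans (key 1 ltr01) _; rewrite ltry.
rewrite IE -(fineK fin_D) -EFinM lee_fin.
have -> : expR (M * (b - a)) * I = phi 0.
  by rewrite /phi addr0 mulr0 mul0r addr0 (mulrC M).
have cphi0 : phi e @[e --> 0^'+] --> phi 0 by apply: cvg_at_right_filter; exact: cphi.
rewrite -(cvg_lim _ cphi0)//; apply: limr_ge; first by apply/cvg_ex; exists (phi 0).
near=> e; rewrite -lee_fin fineK//; apply: key.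
by near: e; exact: nbhs_right_gt.
Unshelve. all: by end_near. Qed.

End volume.

(** * From Lipschitz functions to Borel sets and functions *)

Lemma min1_lipschitz (R : realType) (a b : R) : `|Num.min 1 a - Num.min 1 b| <= `|a - b|.
Proof.
have := ler_norm (a - b); have := ler_norm (b - a); rewrite (distrC b a) => h1 h2.
by rewrite /Num.min; case: ltP => h3; case: ltP => h4;
  rewrite ?subrr ?normr0// ler_norml; apply/andP; split; lra.
Qed.

Section set_distance.
Context (R : realType) (V : normedModType R) (F : set V).
Hypothesis F0 : F !=set0.

Definition set_distance (x : V) : R := inf [set `|x - y| | y in F].

Let has_lb x : has_lbound [set `|x - y| | y in F].
Proof. by exists 0 => _ [y _ <-]. Qed.

Let nonempty x : [set `|x - y| | y in F] !=set0.
Proof. by have [y Fy] := F0; exists `|x - y|; exists y. Qed.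

Lemma set_distance_ge0 x : 0 <= set_distance x.
Proof. by apply: lb_le_inf => // _ [y _ <-]. Qed.

Lemma set_distance_eq0 x : F x -> set_distance x = 0.
Proof.
move=> Fx; apply/eqP; rewrite eq_le set_distance_ge0 andbT.
by apply: ge_inf => //; exists x => //; rewrite subrr normr0.
Qed.

Lemma set_distance_lipschitz x y : `|set_distance x - set_distance y| <= 1 * `|x - y|.
Proof.
have H (a b : V) : set_distance a - `|a - b| <= set_distance b.
  apply: lb_le_inf => // _ [z Fz <-]; rewrite lerBlDr.
  apply: (@le_trans _ _ `|a - z|); first by apply: ge_inf => //; exists z.
  by rewrite [leRHS]addrC (_ : a - z = (a - b) + (b - z)) ?ler_normD// subrKA.
have := H x y; have := H y x; rewrite (distrC y x) mul1r ler_norml => h1 h2.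
by apply/andP; split; lra.
Qed.

Lemma set_distance_gt0 x (e : R) : 0 < e -> (forall y, `|y - x| < e -> ~ F y) ->
  e <= set_distance x.
Proof.
move=> e0 H; apply: lb_le_inf => // _ [y Fy <-]; rewrite leNgt; apply/negP => yx.
by apply: (H y) => //; rewrite distrC.
Qed.

End set_distance.

Section domination.
Context (R : realType) (d : nat) (S : 'rV[R]_d -> 'rV[R]_d) (c : R).
Hypotheses (d0 : (0 < d)%N) (cS : continuous S) (c0 : 0 <= c).
Notation mu := (lebesgue_rV R d).
Hypothesis S_lip : forall (f : 'rV[R]_d -> R) (Lf r : R), 0 <= Lf -> 0 <= r ->
  (forall x, 0 <= f x) -> (forall x y, `|f x - f y| <= Lf * `|x - y|) ->
  (forall x, r < `|x| -> f x = 0) ->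
  (\int[mu]_x (f (S x))%:E <= c%:E * \int[mu]_x (f x)%:E)%E.

Let mS : measurable_fun [set: 'rV[R]_d] S.
Proof. exact: continuous_measurable_rV_rV. Qed.

Let mpre (B : set 'rV[R]_d) : measurable B -> measurable (S @^-1` B).
Proof. by move=> mB; rewrite -[X in measurable X]setTI; exact: mS. Qed.

Let mball (r : R) : 0 <= r -> measurable [set x : 'rV[R]_d | `|x| <= r].
Proof. exact: measurable_rV_cube0. Qed.

(** The function min(1, (n+1) dist(x, ~O)) is Lipschitz, equals 1 on [G n] and vanishes outside [O],
    so it lies between the two indicators. The sets [G n] increase to [O]. *)
Let dominated_open (O : set 'rV[R]_d) (r : R) : 0 <= r -> open O ->
  O `<=` [set x | `|x| <= r] -> (mu (S @^-1` O) <= c%:E * mu O)%E.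
Proof.
move=> r0 oO Or.
(* Positive dimension provides a point outside the bounded set [O]; the distance to the complement
   is then an infimum over a nonempty set. *)
have OC0 : ~` O !=set0.
  exists (const_mx (r + 1)) => /Or /= H.
  have := le_trans (mx_norm_coord _ (Ordinal d0)) H.
  by rewrite mxE ger0_norm ?addr_ge0//; lra.
pose g := set_distance (~` O).
pose G (n : nat) : set 'rV[R]_d := [set x | n.+1%:R^-1 <= g x].
have cg : continuous g := lipschitz_continuous_fun (set_distance_lipschitz OC0).
have mO : measurable O by exact: open_measurable_rV.
have mG n : measurable (G n).
  apply: closed_measurable_rV; rewrite (_ : G n = g @^-1` [set r | n.+1%:R^-1 <= r])//.
  by apply: closed_comp => [x _|]; [exact: cg|exact: closed_ge].
have GO : \bigcup_n G n = O.
  apply/seteqP; split => [x [n _]|x Ox].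
    rewrite /G /= => gx; apply: contrapT => nOx.
    move: gx; rewrite /g set_distance_eq0// leNgt => /negP; apply.
    by rewrite invr_gt0.
  have [e e0 He] := (rV_openP O).1 oO x Ox.
  have [n ne] := natSinv_lt e0.
  exists n => //; rewrite /G /=; apply: le_trans (ltW ne) _.
  by apply: set_distance_gt0 => // y /He Oy /(_ Oy).
have key n : (mu (S @^-1` (G n)) <= c%:E * mu O)%E.
  pose f x := Num.min 1 (n.+1%:R * g x).
  have f0 x : 0 <= f x by rewrite /f le_min ler01 mulr_ge0// set_distance_ge0.
  have fL x y : `|f x - f y| <= n.+1%:R * `|x - y|.
    have H : `|n.+1%:R * g x - n.+1%:R * g y| <= n.+1%:R * `|x - y|.
      rewrite -mulrBr normrM ger0_norm// ler_wpM2l//.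
      by rewrite -[leRHS]mul1r; exact: set_distance_lipschitz.
    by apply: le_trans H; exact: min1_lipschitz.
  have fO x : ~ O x -> f x = 0.
    by move=> nOx; rewrite /f /g set_distance_eq0// mulr0 min_r.
  have fr x : r < `|x| -> f x = 0.
    by move=> rx; apply: fO => /Or /=; rewrite leNgt rx.
  have mf : measurable_fun [set: 'rV[R]_d] (EFin \o f).
    by apply/measurable_EFinP; apply: continuous_measurable_rV; exact: lipschitz_continuous_fun fL.
  have below : (mu (S @^-1` (G n)) <= \int[mu]_x (f (S x))%:E)%E.
    rewrite -(setIT (S @^-1` _)) -integral_indic//; last exact: mpre.
    apply: ge0_le_integral.
    - exact: measurableT.
    - by move=> x _; rewrite lee_fin.
    - by apply/measurable_EFinP; apply: measurable_indic; exact: mpre.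
    - exact: (measurableT_comp mf mS).
    - move=> x _; rewrite lee_fin indicE; case: (boolP (x \in _)) => [|_]; last exact: f0.
      rewrite inE /G /= => gx; rewrite /f le_min lexx/= mulrC.
      by rewrite -ler_pdivrMr// mul1r.
  have above : (\int[mu]_x (f x)%:E <= mu O)%E.
    rewrite -(setIT O) -integral_indic//.
    apply: ge0_le_integral.
    - exact: measurableT.
    - by move=> x _; rewrite lee_fin.
    - exact: mf.
    - by apply/measurable_EFinP; exact: measurable_indic.
    - move=> x _; rewrite lee_fin indicE; case: (boolP (x \in O)) => [_|].
        by rewrite /f ge_min lexx.
      by rewrite notin_setE => /fO ->.
  apply: le_trans below _; apply: le_trans (S_lip (ler0n _ n.+1) r0 f0 fL fr) _.
  by apply: lee_wpmul2l; rewrite ?lee_fin.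
have ndG : nondecreasing_seq (fun n => S @^-1` (G n)).
  move=> m n mn; apply/subsetPset => x; rewrite /G /=; apply: le_trans.
  by rewrite lef_pV2 ?posrE// ler_nat.
have mSG n : measurable (S @^-1` (G n)) by exact: mpre.
have := @nondecreasing_cvg_mu _ _ _ mu _ mSG (bigcupT_measurable _ mSG) ndG.
rewrite -preimage_bigcup GO => hcvg; rewrite -(cvg_lim _ hcvg)//.
by apply: lime_le; [apply/cvg_ex; eexists; exact: hcvg|apply: nearW => n; exact: key].
Qed.

Let dominated_bounded (B : set 'rV[R]_d) (r : R) : 0 <= r -> measurable B ->
  B `<=` [set x | `|x| <= r] -> (mu (S @^-1` B) <= c%:E * mu B)%E.
Proof.
move=> r0 mB Br.
pose U : set 'rV[R]_d := [set x | `|x| < r + 1].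
have oU : open U.
  rewrite (_ : U = (fun x : 'rV[R]_d => `|x|) @^-1` [set s | s < r + 1])//.
  by apply: open_comp; [move=> x _; exact: norm_continuous|exact: open_lt].
have mU := open_measurable_rV oU.
have r10 : 0 <= r + 1 by rewrite addr_ge0.
(* Outer regularity is available for finite measures, so [mu] is first restricted to a slightly
   larger open ball; the approximating open set is then intersected with that ball. *)
pose nu : {measure set 'rV[R]_d -> \bar R} := mrestr mu mU.
have nu_fin : (nu setT < +oo)%E.
  rewrite [nu _]/(mu (setT `&` U)) setTI; 
    apply: (@le_lt_trans _ _ (mu [set x | (`|x| <= r + 1)%R])); last exact: lebesgue_rV_cube_lty.
  by apply: le_measure; rewrite ?inE//; [exact: mball|move=> x /ltW].
apply/lee_addgt0Pr => e e0.
have ec : 0 < e / (c + 1) by rewrite divr_gt0// ltr_wpDl.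
have [G [oG BG nuG]] := measurable_outer_regular nu_fin mB ec.
have BU : B `<=` U by move=> x /Br /= xr; rewrite /U /=; lra.
have oGU : open (G `&` U) by exact: openI.
have mGU := open_measurable_rV oGU.
have GUr : G `&` U `<=` [set x | `|x| <= r + 1] by move=> x [_ /ltW].
apply: (@le_trans _ _ (mu (S @^-1` (G `&` U)))).
  by apply: le_measure; rewrite ?inE; [exact: mpre|exact: mpre|move=> x /= Bx; split; [exact: BG|exact: BU]].
apply: le_trans (dominated_open r10 oGU GUr) _.
have -> : G `&` U = B `|` ((G `\` B) `&` U).
  apply/seteqP; split => x.
    by move=> [Gx Ux]; have [Bx|nBx] := pselect (B x); [left|right].
  by case=> [Bx|[[Gx _] Ux]]; split => //; [exact: BG|exact: BU].
have mGB : measurable ((G `\` B) `&` U).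
  by apply: measurableI => //; apply: measurableD => //; exact: open_measurable_rV.
apply: (@le_trans _ _ (c%:E * (mu B + (e / (c + 1))%:E))%E).
  apply: lee_wpmul2l; first by rewrite lee_fin.
  apply: (@le_trans _ _ (mu B + mu ((G `\` B) `&` U))%E); first exact: measureU2.
  by apply: leeD; [exact: lexx|exact: ltW nuG].
rewrite ge0_muleDr; [|exact: measure_ge0|by rewrite lee_fin ltW].
apply: leeD; first exact: lexx.
rewrite -EFinM lee_fin.
by rewrite mulrCA ger_pMr// ler_pdivrMr ?ltr_wpDl// mul1r lerDl.
Qed.

Lemma dominated_measure (B : set 'rV[R]_d) : measurable B ->
  (mu (S @^-1` B) <= c%:E * mu B)%E.
Proof.
move=> mB; pose Bn (n : nat) := B `&` [set x | `|x| <= n%:R].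
have mBn n : measurable (Bn n) by apply: measurableI => //; exact: mball.
have UB : \bigcup_n Bn n = B.
  apply/seteqP; split => [x [n _ []]//|x Bx].
  by exists (Num.truncn `|x|).+1 => //; split => //=; rewrite ltW// truncnS_gt.
have ndB : nondecreasing_seq (fun n => S @^-1` (Bn n)).
  move=> m n mn; apply/subsetPset => x [/= Bx xm]; split => //=.
  by apply: le_trans xm _; rewrite ler_nat.
have mSB n : measurable (S @^-1` (Bn n)) by exact: mpre.
have := @nondecreasing_cvg_mu _ _ _ mu _ mSB (bigcupT_measurable _ mSB) ndB.
rewrite -preimage_bigcup UB => hcvg; rewrite -(cvg_lim _ hcvg)//.
apply: lime_le; first by apply/cvg_ex; eexists; exact: hcvg.
apply: nearW => n /=.
have Bnr : Bn n `<=` [set x | `|x| <= n%:R] by move=> x [].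
apply: le_trans (dominated_bounded (ler0n _ n) (mBn n) Bnr) _.
apply: lee_wpmul2l; first by rewrite lee_fin.
by apply: le_measure; rewrite ?inE//; move=> x [].
Qed.

Lemma dominated_integral (f : 'rV[R]_d -> \bar R) : (forall x, 0 <= f x)%E ->
  measurable_fun [set: 'rV[R]_d] f ->
  (\int[mu]_x f (S x) <= c%:E * \int[mu]_x f x)%E.
Proof.
move=> f0 mf.
have -> : (\int[mu]_x f (S x) = \int[pushforward mu S]_x f x)%E.
  by rewrite (ge0_integral_pushforward mS) ?preimage_setT// => x _; exact: f0.
have -> : (c%:E * \int[mu]_x f x = \int[mscale (NngNum c0) mu]_x f x)%E.
  by rewrite ge0_integral_mscale.
have := @ge0_le_measure_integral _ _ R
  (measure_function_pushforward__canonical__measure_function_Measure mu mS)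
  (mscale (NngNum c0) mu).
apply => //.
exact: dominated_measure.
Qed.

End domination.

(** * Partial derivatives and operator norm *)

Lemma continuous_near_dist (R : realType) (V W : normedModType R) (f : V -> W) x (e : R) :
  {for x, continuous f} -> 0 < e -> \forall y \near x, `|f x - f y| < e.
Proof. by move=> /cvgrPdist_lt cf e0; exact: cf. Qed.

Lemma MVT_between (R : realType) (f f' : R -> R) (a b : R) :
  (forall s : R, is_derive s 1 f (f' s)) ->
  exists c, `|c - a| <= `|b - a| /\ f b - f a = f' c * (b - a).
Proof.
move=> df; have cf (A : set R) : {within A, continuous f}.
  apply: continuous_subspaceT => s; apply/differentiable_continuous/derivable1_diffP.
  by have [] := df s.
have [ab|/ltW ba] := leP a b.
  have [c] := @MVT_segment R f f' a b ab (fun s _ => df s) (cf _).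
  rewrite in_itv/= => /andP[ac cb] E; exists c; split => //.
  by rewrite !ger0_norm ?subr_ge0//; lra.
have [c] := @MVT_segment R f f' b a ba (fun s _ => df s) (cf _).
rewrite in_itv/= => /andP[bc ca] E; exists c; split.
  by rewrite !ler0_norm ?subr_le0//; lra.
by rewrite -opprB E; ring.
Qed.

(* Changing the coordinates of [y] into those of [x] one at a time. *)
Lemma increment_partials (R : realType) d (f : 'rV[R]_d -> R)
    (g : 'I_d -> 'rV[R]_d -> R) (x y : 'rV[R]_d) :
  (forall j z, is_derive z (delta_mx ord0 j) f (g j z)) ->
  exists xi : 'I_d -> 'rV[R]_d, (forall j, `|xi j - y| <= `|x - y|) /\
    f x - f y = \sum_j g j (xi j) * (x ord0 j - y ord0 j).
Proof.
move=> dg; pose z (k : nat) : 'rV[R]_d := \row_j (if (j < k)%N then x ord0 j else y ord0 j).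
have /choice[xi Hxi] (j : 'I_d) : exists xi : 'rV[R]_d, `|xi - y| <= `|x - y| /\
    f (z j.+1) - f (z j) = g j xi * (x ord0 j - y ord0 j).
  have [c [cxy E]] := @MVT_between R (fun u => f (rV_upd (z j) j u))
    (fun u => g j (rV_upd (z j) j u)) (y ord0 j) (x ord0 j)
    (fun s => is_derive_line (z j) s (dg j)).
  exists (rV_upd (z j) j c); split.
    apply: mx_norm_le => // i; rewrite !mxE; have := mx_norm_coord (x - y) i; rewrite !mxE.
    case: eqP => [->|_]; first exact: le_trans.
    by case: ifP => // _ _; rewrite subrr normr0.
  rewrite -E; congr (f _ - f _); apply/rowP => i; rewrite !mxE.
    by case: eqP => [->|/eqP ij]; [rewrite ltnSn|rewrite ltnS leq_eqVlt (inj_eq val_inj) (negbTE ij)].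
  by case: eqP => [->|//]; rewrite ltnn.
exists xi; split; first by move=> j; have [] := Hxi j.
rewrite -(eq_bigr _ (fun j _ => (Hxi j).2)) -(big_mkord xpredT (fun k => f (z k.+1) - f (z k))).
rewrite telescope_sumr//; congr (f _ - f _); apply/rowP => i; rewrite !mxE//.
by rewrite ltn_ord.
Qed.

Lemma bounded_partials_lipschitz (R : realType) d (f : 'rV[R]_d -> R)
    (g : 'I_d -> 'rV[R]_d -> R) (L : R) : 0 <= L ->
  (forall j z, is_derive z (delta_mx ord0 j) f (g j z)) ->
  (forall j z, `|g j z| <= L) ->
  forall x y, `|f x - f y| <= d%:R * L * `|x - y|.
Proof.
move=> L0 dg gL x y; have [xi [_ ->]] := increment_partials x y dg.
apply: le_trans (ler_norm_sum _ _ _) _.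
rewrite -mulrA -[X in _ <= X%:R * _]card_ord mulr_natl -sumr_const.
apply: ler_sum => j _; rewrite normrM; apply: ler_pM => //.
by have := mx_norm_coord (x - y) j; rewrite !mxE.
Qed.

Lemma mulmxr_continuous (R : realType) m n (M : 'M[R]_(m, n)) :
  continuous (mulmxr M : 'rV[R]_m -> 'rV[R]_n).
Proof.
apply: (@lipschitz_continuous_fun R _ _ (\sum_i \sum_j `|M i j|)) => x y.
rewrite -linearB /=; apply: mx_norm_le => [|j].
  by rewrite mulr_ge0// sumr_ge0// => i _; rewrite sumr_ge0.
rewrite mxE mulr_suml; apply: le_trans (ler_norm_sum _ _ _) _.
apply: ler_sum => i _; rewrite normrM mulrC; apply: ler_pM => //; last exact: mx_norm_coord.
by rewrite (bigD1 j)//= lerDl sumr_ge0.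
Qed.

Lemma is_derive_coord (R : realType) d m (f : 'rV[R]_d -> 'rV[R]_m) x v i :
  derivable f x v -> is_derive x v (fun y => f y ord0 i) ('D_v f x ord0 i).
Proof.
move=> df; have H : (h^-1 *: (((fun y => f y ord0 i) \o shift x) (h *: v) - f x ord0 i)) @[h --> 0^']
    --> 'D_v f x ord0 i.
  move/(continuous_cvg _ (@coord_continuous R 1 m ord0 i ('D_v f x))) : df.
  by apply: cvg_trans; apply: near_eq_cvg; near=> h; rewrite /= !mxE.
by apply: DeriveDef; [apply/cvg_ex; eexists; exact: H|exact/cvg_lim].
Unshelve. all: by end_near. Qed.

(** A C^1 field is given through derivatives along the axes, whereas ['J] is defined from the
    differential; this identifies its entries with the partial derivatives. Each of the [d]
    increments is off by at most |h| e/(d+1). *)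
Lemma differentiable_partials (R : realType) d m (f : 'rV[R]_d -> 'rV[R]_m) :
  (forall j x, derivable f x (delta_mx ord0 j)) ->
  (forall j, continuous ('D_(delta_mx ord0 j) f)) ->
  forall x, differentiable f x.
Proof.
move=> df cf x.
pose M : 'M[R]_(d, m) := \matrix_(j, i) 'D_(delta_mx ord0 j) f x ord0 i.
have H : f \o shift x = cst (f x) + mulmxr M +o_ 0 id.
  apply/eqaddoP => _/posnumP[e].
  pose e' := e%:num / d.+1%:R.
  have e'0 : 0 < e' by rewrite divr_gt0.
  have : \forall y \near x, forall j, `|'D_(delta_mx ord0 j) f x - 'D_(delta_mx ord0 j) f y| < e'.
    apply: (@filter_forall _ _ _ (nbhs x) (nbhs_filter x)) => j.
    exact: (continuous_near_dist (cf j x) e'0).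
  move=> /nbhs_ballP[r /= r0 Hr].
  apply/nbhs_ballP; exists r => // h /=.
  rewrite -ball_normE /= sub0r normrN => hr.
  rewrite [X in `|X|](_ : _ = f (h + x) - (f x + h *m M))//.
  apply: mx_norm_le => [|i]; first by rewrite mulr_ge0.
  have [xi [xiE E]] := increment_partials (h + x) x
    (fun j z => is_derive_coord i (df j z)).
  rewrite !mxE opprD addrA E -sumrB; apply: le_trans (ler_norm_sum _ _ _) _.
  apply: (@le_trans _ _ (\sum_(j < d) e' * `|h|)).
    apply: ler_sum => j _; rewrite /M !mxE addrK [h ord0 j * _]mulrC -mulrBl normrM.
    apply: ler_pM => //; last exact: mx_norm_coord.
    have xj : ball x r (xi j).
      rewrite -ball_normE /= distrC; apply: le_lt_trans (xiE j) _.
      by rewrite addrK.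
    have := mx_norm_coord ('D_(delta_mx ord0 j) f x - 'D_(delta_mx ord0 j) f (xi j)) i.
    rewrite !mxE distrC => /le_trans; apply; apply: ltW; exact: Hr.
  rewrite sumr_const card_ord -mulr_natl mulrA ler_wpM2r//.
  by rewrite /e' mulrCA ger_pMr// ler_pdivrMr// mul1r ler_nat.
by apply/diff_locallyP; rewrite (diff_unique (@mulmxr_continuous _ _ _ M) H); split => //;
  exact: mulmxr_continuous.
Qed.

Lemma jacobian_coord (R : realType) d m (f : 'rV[R]_d -> 'rV[R]_m) x j i :
  differentiable f x -> 'D_(delta_mx ord0 j) f x ord0 i = ('J f x) j i.
Proof. by move=> df; rewrite deriveEjacobian// -rowE mxE. Qed.

Lemma enorm_coord (R : realType) d (v : 'rV[R]_d) i : `|v ord0 i| <= enorm v.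
Proof.
rewrite /enorm -sqrtr_sqr ler_sqrt ?sumr_ge0// => [|j _]; last exact: sqr_ge0.
by rewrite (bigD1 i)//= lerDl sumr_ge0// => j _; exact: sqr_ge0.
Qed.

(** The supremum must be shown to be over a bounded set: coordinates of a vector of the unit ball
    are at most 1, so those of its image are bounded by sums of absolute values of entries. *)
Lemma opnorm_ge (R : realType) m n (M : 'M[R]_(m, n)) (v : 'rV[R]_m) :
  enorm v <= 1 -> enorm (v *m M) <= opnorm M.
Proof.
move=> v1; apply: ub_le_sup; last by exists v.
exists (Num.sqrt (\sum_(j < n) (\sum_(i < m) `|M i j|) ^+ 2)) => _ [w w1 <-].
rewrite /enorm ler_sqrt ?sumr_ge0// => [|j _]; last exact: sqr_ge0.
apply: ler_sum => j _; rewrite -[leLHS]real_normK ?num_real//.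
apply: lerXn2r; rewrite ?nnegrE ?normr_ge0 ?sumr_ge0// mxE.
apply: le_trans (ler_norm_sum _ _ _) _; apply: ler_sum => i _.
rewrite normrM ler_piMl//; exact: le_trans (enorm_coord _ _) w1.
Qed.

(** A basis vector has norm 1 and its image is a row of [M]. This passes from the Euclidean
    hypothesis to entrywise bounds suited to the sup norm. *)
Lemma opnorm_coord (R : realType) m n (M : 'M[R]_(m, n)) i j : `|M i j| <= opnorm M.
Proof.
have d1 : enorm (delta_mx ord0 i : 'rV[R]_m) <= 1.
  rewrite /enorm (bigD1 i)//= big1 => [|k ki]; last by rewrite mxE eqxx (negbTE ki) expr0n.
  by rewrite mxE !eqxx expr1n addr0 sqrtr1.
apply: le_trans (opnorm_ge M d1); rewrite -rowE.
by have := enorm_coord (row i M) j; rewrite mxE.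
Qed.

Lemma within_clamp_field (R : realType) d (T : R) (V : topologicalType)
    (F : 'rV[R]_d -> R -> V) : 0 <= T ->
  {within [set: 'rV[R]_d] `*` [set` `[0, T]], continuous (fun p => F p.1 p.2)} ->
  continuous (fun p : 'rV[R]_d * R => F p.1 (clamp T p.2)).
Proof.
move=> T0 /subspace_continuousP cF p.
have pD : ([set: 'rV[R]_d] `*` [set` `[0, T]]) (p.1, clamp T p.2).
  by split => //; exact: clamp_in.
have cG : continuous (fun q : 'rV[R]_d * R => (q.1, clamp T q.2)).
  move=> q; have c2 : continuous (fun q : 'rV[R]_d * R => clamp T q.2).
    by move=> z; apply: (@continuous_comp _ _ _ snd (clamp T)); [exact: cvg_snd|exact: clamp_continuous].
  exact: (cvg_pair cvg_fst (c2 q)).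
suff : forall B, nbhs (F p.1 (clamp T p.2)) B ->
  \forall q \near p, B (F q.1 (clamp T q.2)) by [].
move=> B /(cF _ pD) HB.
have {}HB : \forall q \near (p.1, clamp T p.2),
  ([set: 'rV[R]_d] `*` [set` `[0, T]]) q -> B (F q.1 q.2) by exact: HB.
near=> q; have : ([set: 'rV[R]_d] `*` [set` `[0, T]]) (q.1, clamp T q.2).
  by split => //; exact: clamp_in.
by near: q; exact: (cG p _ HB).
Unshelve. all: by end_near. Qed.

(** * Duality *)

(** For either sign the difference is the square (c a - s b)^2 / (2c). When [c] is the domination
    constant of [S], the second term integrates to half of the undistorted square integral. *)
Lemma normr_mul_le_squares (R : realFieldType) (c a b : R) : 0 < c ->
  `|a * b| <= c / 2 * a ^+ 2 + (2 * c)^-1 * b ^+ 2.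
Proof.
move=> c0; have c2 : 0 <= (2 * c)^-1 by rewrite invr_ge0 mulr_ge0// ltW.
have e s : s ^+ 2 = 1 -> c / 2 * a ^+ 2 + (2 * c)^-1 * b ^+ 2 - s * (a * b) =
    (2 * c)^-1 * (c * a - s * b) ^+ 2.
  by move=> s2; rewrite sqrrB [(s * b) ^+ 2]exprMn s2; field; rewrite gt_eqF.
have h s : s ^+ 2 = 1 -> s * (a * b) <= c / 2 * a ^+ 2 + (2 * c)^-1 * b ^+ 2.
  by move=> s2; rewrite -subr_ge0 e// mulr_ge0// sqr_ge0.
rewrite ler_norml lerNl -mulN1r (h (-1)) ?sqrrN ?expr1n//=.
by rewrite -[leLHS]mul1r h// expr1n.
Qed.

Section duality.
Context d (X : measurableType d) (R : realType) (mu : {measure set X -> \bar R}).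

Lemma square_integrable_mul (f g : X -> R) :
  measurable_fun [set: X] f -> measurable_fun [set: X] g ->
  (\int[mu]_x (f x ^+ 2)%:E < +oo)%E -> (\int[mu]_x (g x ^+ 2)%:E < +oo)%E ->
  mu.-integrable [set: X] (EFin \o (fun x => f x * g x)).
Proof.
move=> mf mg f2 g2; have m2 (k : X -> R) : measurable_fun [set: X] k ->
    measurable_fun [set: X] (fun x => (k x ^+ 2)%:E).
  by move=> mk; apply/measurable_EFinP; exact: measurable_funX.
have p2 (k : X -> R) x : (0 <= (k x ^+ 2)%:E)%E by rewrite lee_fin sqr_ge0.
apply/integrableP; split; first by apply/measurable_EFinP; exact: measurable_funM.
apply: (@le_lt_trans _ _ (\int[mu]_x ((f x ^+ 2)%:E + (g x ^+ 2)%:E))%E); last first.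
  by rewrite ge0_integralD//; [exact: lte_add_pinfty|exact: m2|exact: m2].
apply: ge0_le_integral.
- exact: measurableT.
- by move=> x _; exact: abse_ge0.
- by apply: measurableT_comp => //; apply/measurable_EFinP; exact: measurable_funM.
- by apply: emeasurable_funD; exact: m2.
- move=> x _; rewrite /= -EFinD lee_fin ler_norml; apply/andP; split.
    by have := sqr_ge0 (f x + g x); have := sqr_ge0 (f x); have := sqr_ge0 (g x);
      rewrite sqrrD; lra.
  by have := sqr_ge0 (f x - g x); have := sqr_ge0 (f x); have := sqr_ge0 (g x);
    rewrite sqrrB; lra.
Qed.

Context (S : X -> X) (c : R) (w w0 : X -> R) (E : nat -> set X).
Hypotheses (mS : measurable_fun [set: X] S) (c0 : 0 < c).
Hypothesis S_dom : forall f : X -> \bar R, (forall x, 0 <= f x)%E ->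
  measurable_fun [set: X] f -> (\int[mu]_x f (S x) <= c%:E * \int[mu]_x f x)%E.
Hypotheses (mw : measurable_fun [set: X] w) (mw0 : measurable_fun [set: X] w0).
Hypotheses (mE : forall n, measurable (E n)) (ndE : nondecreasing_seq E).
Hypotheses (E_fin : forall n, (mu (E n) < +oo)%E) (wE : forall x, w x != 0 -> (\bigcup_n E n) x).

(** Two cuts are made: the set [E n] fixes the support, and the level [n] gives boundedness.
    Together they make the square integral finite. *)
Definition truncation (n : nat) (x : X) : R :=
  w x * \1_(E n `&` [set x | `|w x| <= n%:R]) x.

Let mEn n : measurable (E n `&` [set x | `|w x| <= n%:R]).
Proof.
apply: measurableI => //; rewrite -[X in measurable X]setTI.
rewrite (_ : [set x | _] = w @^-1` `[- n%:R, n%:R]); first exact: mw.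
by apply/seteqP; split => x /=; rewrite in_itv/= ler_norml.
Qed.

Lemma measurable_truncation n : measurable_fun [set: X] (truncation n).
Proof. by apply: measurable_funM => //; exact: measurable_indic. Qed.

Lemma truncation_out n x : ~ E n x -> truncation n x = 0.
Proof.
by move=> nE; rewrite /truncation indicE memNset ?mulr0// => -[].
Qed.

Lemma truncation_norm n x : `|truncation n x| <= n%:R.
Proof.
rewrite /truncation indicE; case: (boolP (x \in _)) => [|_]; last by rewrite mulr0 normr0.
by rewrite inE => -[_ wn]; rewrite mulr1.
Qed.

Lemma truncation_square_fin n : (\int[mu]_x (truncation n x ^+ 2)%:E < +oo)%E.
Proof.
apply: (@le_lt_trans _ _ (\int[mu]_x ((n%:R ^+ 2)%:E * (\1_(E n) x)%:E))%E).
  apply: ge0_le_integral.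
  - exact: measurableT.
  - by move=> x _; rewrite lee_fin sqr_ge0.
  - by apply/measurable_EFinP; apply: measurable_funX; exact: measurable_truncation.
  - by apply: measurable_funeM; apply/measurable_EFinP; exact: measurable_indic.
  - move=> x _; rewrite -EFinM lee_fin /truncation !indicE.
    have [[Ex wx]|H] := pselect ((E n `&` [set x | `|w x| <= n%:R]) x).
      rewrite !mem_set//= !mulr1 -[leLHS]real_normK ?num_real//.
      by apply: lerXn2r; rewrite ?nnegrE.
    by rewrite (memNset H) mulr0 expr0n/= mulr_ge0// sqr_ge0.
rewrite ge0_integralZl_EFin//; last first.
  by apply/measurable_EFinP; exact: measurable_indic.
by rewrite integral_indic// setIT; exact: lte_mul_pinfty.
Qed.

Hypothesis identity : forall n,
  (\int[mu]_x (w x * truncation n x)%:E = \int[mu]_x (w0 x * truncation n (S x))%:E)%E.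

Let truncation_bound n :
  (\int[mu]_x (truncation n x ^+ 2)%:E <= c%:E * \int[mu]_x (w0 x ^+ 2)%:E)%E.
Proof.
have m2 (k : X -> R) : measurable_fun [set: X] k ->
    measurable_fun [set: X] (fun x => (k x ^+ 2)%:E).
  by move=> mk; apply/measurable_EFinP; exact: measurable_funX.
have p2 (k : X -> R) x : (0 <= (k x ^+ 2)%:E)%E by rewrite lee_fin sqr_ge0.
set Y := (\int[mu]_x (truncation n x ^+ 2)%:E)%E.
set Z := (\int[mu]_x (w0 x ^+ 2)%:E)%E.
(* Finiteness is what permits subtracting Y/2 from both sides at the end. *)
have Yfin : Y \is a fin_num.
  by rewrite ge0_fin_numE ?truncation_square_fin//; apply: integral_ge0 => x _.
have Z0 : (0 <= Z)%E by apply: integral_ge0 => x _.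
have mtS : measurable_fun [set: X] (truncation n \o S).
  exact: measurableT_comp (measurable_truncation n) mS.
have : (Y <= (c / 2)%:E * Z + (2^-1)%:E * Y)%E.
  (* At each point the truncation is [w] or 0, so its product with [w] is its own square. *)
  have YE : Y = (\int[mu]_x (w0 x * truncation n (S x))%:E)%E.
    rewrite -identity; apply: eq_integral => x _; congr (_%:E).
    rewrite /truncation indicE; case: (_ \in _); last by rewrite !mulr0 expr0n.
    by rewrite !mulr1.
  rewrite [leLHS]YE; apply: le_trans (lee_abs _) _.
  apply: le_trans (le_abse_integral _ _ _) _ => //.
    by apply/measurable_EFinP; exact: measurable_funM.
  apply: (@le_trans _ _ (\int[mu]_x ((c / 2)%:E * (w0 x ^+ 2)%:E +
      (2 * c)^-1%:E * (truncation n (S x) ^+ 2)%:E))%E).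
    apply: ge0_le_integral.
    - exact: measurableT.
    - by move=> x _; exact: abse_ge0.
    - by apply: measurableT_comp => //; apply/measurable_EFinP; exact: measurable_funM.
    - apply: emeasurable_funD; apply: measurable_funeM; first exact: m2.
      exact: (m2 (truncation n \o S)).
    - move=> x _ /=; rewrite -!EFinM -EFinD lee_fin.
      exact: normr_mul_le_squares.
  rewrite ge0_integralD//; first last.
  - by apply: measurable_funeM; exact: (m2 (truncation n \o S)).
  - by move=> x _; rewrite -EFinM lee_fin mulr_ge0 ?sqr_ge0// invr_ge0 mulr_ge0// ltW.
  - by apply: measurable_funeM; exact: m2.
  - by move=> x _; rewrite -EFinM lee_fin mulr_ge0 ?sqr_ge0// divr_ge0// ltW.
  rewrite !ge0_integralZl_EFin//; first last.
  - by rewrite divr_ge0// ltW.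
  - exact: m2.
  - by rewrite invr_ge0 mulr_ge0// ltW.
  - exact: (m2 (truncation n \o S)).
  apply: leeD; first exact: lexx.
  have := S_dom (p2 (truncation n)) (m2 _ (measurable_truncation n)) => H.
  apply: (@le_trans _ _ ((2 * c)^-1%:E * (c%:E * Y))%E).
    by apply: lee_wpmul2l => //; rewrite lee_fin invr_ge0 mulr_ge0// ltW.
  rewrite muleA -EFinM (_ : (2 * c)^-1 * c = 2^-1)//.
  by field; rewrite gt_eqF.
move: Z0; case: Z => [z||]// z0.
  by rewrite -(fineK Yfin) -!EFinM -EFinD !lee_fin; lra.
by move=> _; rewrite gt0_muley ?lte_fin// leey.
Qed.

(* Testing with the truncations of [w] itself: AM-GM leaves half of their
   square integral on the right-hand side, where it is absorbed. *)
Lemma duality_bound :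
  (\int[mu]_x (w x ^+ 2)%:E <= c%:E * \int[mu]_x (w0 x ^+ 2)%:E)%E.
Proof.
pose g n x := (truncation n x ^+ 2)%:E.
have mg n : measurable_fun [set: X] (g n).
  by apply/measurable_EFinP; apply: measurable_funX; exact: measurable_truncation.
have g0 n x : setT x -> (0 <= g n x)%E by rewrite lee_fin sqr_ge0.
have subE m n : (m <= n)%N -> E m `&` [set x | `|w x| <= m%:R] `<=`
    E n `&` [set x | `|w x| <= n%:R].
  move=> mn x [Em wm]; split; first by move/subsetPset : (ndE mn); exact.
  by apply: le_trans wm _; rewrite ler_nat.
have ndg x : setT x -> {homo g^~ x : n m / (n <= m)%N >-> (n <= m)%E}.
  move=> _ m n mn; rewrite /g /truncation lee_fin !indicE.
  case: (boolP (x \in _)) => [|_]; last by rewrite mulr0 expr0n sqr_ge0.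
  by rewrite inE => /(subE _ _ mn) H; rewrite mem_set.
have limg x : limn (g^~ x) = (w x ^+ 2)%:E.
  apply: cvg_lim => //; apply: cvg_near_cst.
  have [wx0|wx0] := eqVneq (w x) 0.
    by apply: nearW => n; rewrite /g /truncation wx0 mul0r.
  have [m _ Em] := wE wx0.
  (* From [N] on, the point lies in [E n] and |w x| is below the level, so the truncation at that
     point has become [w x]. *)
  pose N := maxn m (Num.truncn `|w x|).+1.
  exists N => // n /= Nn; rewrite /g /truncation indicE mem_set ?mulr1//; split.
    have mn : (m <= n)%N by apply: leq_trans Nn; exact: leq_maxl.
    by move/subsetPset : (ndE mn); exact.
  rewrite /= ltW//; apply: lt_le_trans (truncnS_gt _) _; rewrite ler_nat.
  by apply: leq_trans Nn; exact: leq_maxr.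
have H := @cvg_monotone_convergence _ _ _ mu setT measurableT g mg g0 ndg.
under eq_integral do rewrite -limg.
rewrite -(cvg_lim _ H)//; apply: lime_le; first by apply/cvg_ex; eexists; exact: H.
by apply: nearW => n; exact: truncation_bound.
Qed.

End duality.

(** * Lipschitz and volume bounds for a C^1 field *)

Section C1_field.
Context (R : realType) (d : nat) (T L M : R) (A : 'rV[R]_d -> R -> 'rV[R]_d).
Hypotheses (d0 : (0 < d)%N) (T0 : 0 <= T) (A1 : C1_field T A) (L0 : 0 < L) (M0 : 0 <= M).
Hypothesis gradA : forall x t, t \in `[0, T] -> opnorm (spatial_jacobian A x t) <= L.
Hypothesis divA : forall x t, t \in `[0, T] -> `|divergence A x t| <= M.

Lemma C1_continuous : continuous (fun q : 'rV[R]_d * R => A q.1 (clamp T q.2)).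
Proof. by case: A1 => cA _ _; exact: within_clamp_field. Qed.

Let partial_continuous j :
  continuous (fun q : 'rV[R]_d * R => 'D_(delta_mx ord0 j) (A ^~ (clamp T q.2)) q.1).
Proof.
case: A1 => _ /(_ j)[_ cD] _.
exact: (@within_clamp_field R d T _ (fun x t => 'D_(delta_mx ord0 j) (A ^~ t) x)).
Qed.

Lemma C1_differentiable x t : t \in `[0, T] -> differentiable (A ^~ t) x.
Proof.
move=> tT; apply: differentiable_partials => j.
  by case: A1 => _ /(_ j)[dA _] _ y; exact: dA.
exact: (@fixed_time_continuous R d T _ (fun x t => 'D_(delta_mx ord0 j) (A ^~ t) x) t tT).
Qed.

Let partial_derive j i x t : t \in `[0, T] ->
  is_derive x (delta_mx ord0 j) (fun y => A y t ord0 i) (spatial_jacobian A x t j i).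
Proof.
move=> tT; rewrite /spatial_jacobian -jacobian_coord; last exact: C1_differentiable.
by apply: is_derive_coord; case: A1 => _ /(_ j)[dA _] _; exact: dA.
Qed.

Lemma C1_lipschitz x y t : t \in `[0, T] -> `|A x t - A y t| <= d%:R * L * `|x - y|.
Proof.
move=> tT; apply: mx_norm_le => [|i]; first by rewrite !mulr_ge0// ltW.
rewrite !mxE; apply: (@bounded_partials_lipschitz R d (fun y => A y t ord0 i)
  (fun j x => spatial_jacobian A x t j i) L (ltW L0)) => j z.
  exact: partial_derive.
exact: le_trans (opnorm_coord _ _ _) (gradA _ tT).
Qed.

Lemma C1_lipschitz_gt0 : 0 < d%:R * L.
Proof. by rewrite mulr_gt0// ltr0n. Qed.

Lemma flow_continuous a b : a \in `[0, T] -> b \in `[0, T] -> continuous (flow A T a b).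
Proof.
move=> aT bT; apply: (@lipschitz_continuous_fun R _ _ (2 * expR (2 * (d%:R * L) * T))) => x y.
exact: (flow_lipschitz T0 C1_lipschitz_gt0 C1_continuous C1_lipschitz).
Qed.

Lemma flow_volume (t : R) : t \in `[0, T] -> forall f : 'rV[R]_d -> \bar R,
  (forall x, 0 <= f x)%E -> measurable_fun [set: 'rV[R]_d] f ->
  (\int[lebesgue_rV R d]_x f (flow A T 0 t x) <=
   (expR (M * t))%:E * \int[lebesgue_rV R d]_x f x)%E.
Proof.
move=> tT; have oT : 0 \in `[0, T] by rewrite in_itv/= lexx.
apply: dominated_integral => //; first exact: flow_continuous.
move=> f Lf r Lf0 r0 f0 fL fr; rewrite -[X in expR (_ * X)]subr0.
(* Only diagonal entries of the Jacobian enter through the shears; their sum is the trace, that is,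
   the divergence. *)
apply: (flow_volume_lipschitz (p := fun i x t => spatial_jacobian A x t i i) T0 C1_lipschitz_gt0
  L0 M0 C1_continuous C1_lipschitz _ _ _ _ oT tT _ Lf0 r0 f0 fL fr).
- by move=> i x s sT; exact: partial_derive.
- move=> i; rewrite (_ : (fun q => _) = (fun q : 'rV[R]_d * R =>
      'D_(delta_mx ord0 i) (A ^~ (clamp T q.2)) q.1 ord0 i)).
    move=> q; apply: (@continuous_comp _ _ _ (fun q : 'rV[R]_d * R =>
      'D_(delta_mx ord0 i) (A ^~ (clamp T q.2)) q.1) (fun v : 'rV[R]_d => v ord0 i)).
      exact: partial_continuous.
    exact: coord_continuous.
  apply/funext => q; rewrite /spatial_jacobian jacobian_coord//.
  by apply: C1_differentiable; exact: clamp_in.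
- by move=> i x s sT; exact: le_trans (opnorm_coord _ _ _) (gradA _ sT).
- by move=> x s sT; have := divA x sT; rewrite ler_norml => /andP[].
- by move: tT; rewrite in_itv/= => /andP[].
Qed.

End C1_field.

(** * Solutions of the integral invariant model *)

Lemma bounded_set_norm (R : realType) (V : normedModType R) (F : set V) : bounded_set F ->
  exists2 r, 0 <= r & forall x, F x -> `|x| <= r.
Proof.
move=> [r [_ Hr]]; exists (Num.max 0 (r + 1)); first by rewrite le_max lexx.
by move=> x Fx; apply: (Hr (Num.max 0 (r + 1))) => //; rewrite lt_max ltrDl ltr01 orbT.
Qed.

(** The points at distance at least 1/(n+1) from the complement, phrased without a distance so that
    an empty complement causes no exception. For a bounded open set in R^d these are compact sets
    exhausting it. *)
Definition inner_core (R : realType) (V : normedModType R) (O : set V) (n : nat) : set V :=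
  [set z | forall y, `|y - z| < n.+1%:R^-1 -> O y].

Section inner_core.
Context (R : realType) (V : normedModType R) (O : set V).

Lemma inner_core_sub n : inner_core O n `<=` O.
Proof. by move=> z; apply; rewrite subrr normr0 invr_gt0. Qed.

Lemma inner_core_nondecreasing : nondecreasing_seq (inner_core O).
Proof.
move=> m n mn; apply/subsetPset => z Oz y yz; apply: Oz; apply: lt_le_trans yz _.
by rewrite lef_pV2 ?posrE// ler_nat.
Qed.

Lemma inner_core_bigcup z : open O -> O z -> (\bigcup_n inner_core O n) z.
Proof.
move=> oO /(open_subball oO)[e /= e0 He].
have [n ne] := natSinv_lt e0.
exists n => // y yz; apply: (He n.+1%:R^-1).
- by rewrite /ball_/= sub0r normrN gtr0_norm ?invr_gt0.
- by rewrite invr_gt0.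
- by rewrite -ball_normE /= distrC.
Qed.

Lemma inner_core_closed n : closed (inner_core O n).
Proof.
move=> z Kz y yz.
have e0 : 0 < n.+1%:R^-1 - `|y - z| by rewrite subr_gt0.
have [z' [Oz']] := Kz _ (nbhsx_ballx z _ e0).
rewrite -ball_normE /= => zz'; apply: Oz'.
apply: le_lt_trans (ler_distD z _ _) _; by rewrite -ltrBrDl.
Qed.

End inner_core.

Section L2.
Context (R : realType) (d : nat).
Implicit Types (f g u v : 'rV[R]_d -> R).
Local Notation mu := (lebesgue_rV R d).

Lemma L2normE (G : set 'rV[R]_d) f :
  L2norm G f = ((\int[mu]_x ((f \_ G) x ^+ 2)%:E) `^ 2^-1)%E.
Proof.
rewrite /L2norm unlock /=; congr (_ `^ _)%E; apply: eq_integral => x _.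
by rewrite /= powR_mulrn// real_normK// num_real.
Qed.

Lemma square_restrict_ge0 (G : set 'rV[R]_d) f : (0 <= \int[mu]_x ((f \_ G) x ^+ 2)%:E)%E.
Proof. by apply: integral_ge0 => x _; rewrite lee_fin sqr_ge0. Qed.

Lemma L2norm_lty (G : set 'rV[R]_d) f :
  (L2norm G f < +oo)%E <-> (\int[mu]_x ((f \_ G) x ^+ 2)%:E < +oo)%E.
Proof.
rewrite L2normE; split; last exact: poweR_lty.
by apply: lty_poweRy; rewrite invr_neq0.
Qed.

Lemma le_L2norm (G G' : set 'rV[R]_d) f g (a : R) :
  (\int[mu]_x ((f \_ G) x ^+ 2)%:E <= (expR a)%:E * \int[mu]_x ((g \_ G') x ^+ 2)%:E)%E ->
  (L2norm G f <= (expR (a / 2))%:E * L2norm G' g)%E.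
Proof.
move=> H; rewrite !L2normE expRM -poweR_EFin -poweRM ?lee_fin ?expR_ge0 ?square_restrict_ge0//.
apply: gt0_ler_poweR => //; rewrite ?invr_ge0// in_itv/= leey andbT ?square_restrict_ge0//.
by rewrite mule_ge0 ?square_restrict_ge0// lee_fin expR_ge0.
Qed.

Lemma in_L2_setT_sub (G : set 'rV[R]_d) f : measurable G -> in_L2 setT f -> in_L2 G f.
Proof.
move=> mG [mf f2]; split; first exact: measurable_funS mf.
move: f2; rewrite !L2norm_lty; apply: le_lt_trans.
rewrite [in leRHS]patch_setT.
apply: ge0_le_integral => //.
- by move=> x _; rewrite lee_fin sqr_ge0.
- apply/measurable_EFinP; apply: measurable_funX.
  apply/(measurable_restrictT _ mG); exact: measurable_funS mf.
- by apply/measurable_EFinP; exact: measurable_funX.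
- move=> x _; rewrite lee_fin patchE; case: ifP => // _.
  by rewrite expr0n sqr_ge0.
Qed.

Lemma Rintegral_restrict_sub (G : set 'rV[R]_d) u v g : measurable G ->
  in_L2 G u -> in_L2 G v -> measurable_fun setT g ->
  (\int[mu]_x (g x ^+ 2)%:E < +oo)%E ->
  (\int[mu]_x (((fun y => u y - v y) \_ G) x * g x)%:E)%E =
  (\int[mu]_(x in G) (u x * g x) - \int[mu]_(x in G) (v x * g x))%:E.
Proof.
move=> mG [/measurable_restrictT-/(_ mG) mu_ /L2norm_lty u2].
move=> [/measurable_restrictT-/(_ mG) mv /L2norm_lty v2] mg g2.
have iu := square_integrable_mul mu_ mg u2 g2.
have iv := square_integrable_mul mv mg v2 g2.
have E (w : 'rV[R]_d -> R) : (fun x => w x * g x) \_ G = (fun x => (w \_ G) x * g x).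
  by apply/funext => x; rewrite !patchE; case: ifP => //; rewrite mul0r.
rewrite [X in X - _]Rintegral_mkcond [X in _ - X]Rintegral_mkcond !E -RintegralB// /Rintegral fineK; last first.
  by rewrite integralB_EFin// fin_numB; apply/andP; split; exact: integrable_fin_num.
apply: eq_integral => x _; rewrite -mulrBl !patchE; case: ifP => // _.
by rewrite subr0.
Qed.

Lemma H0_compact (O K : set 'rV[R]_d) f (r : R) : compact K -> K `<=` O ->
  measurable_fun setT f -> (forall x, `|f x| <= r) -> (forall x, ~ K x -> f x = 0) -> H0 O f.
Proof.
move=> cK KO mf fr fK.
have clK : closed K by apply: compact_closed => //; exact: norm_hausdorff.
have sub : ess_supp f `<=` K.
  move=> x; apply: contra_notP => nKx; exists (~` K) => //; split.
    exact: closed_openC.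
  by apply: aeW => y; exact: fK.
split; last exact: subset_trans sub KO.
- split=> //; apply/L2norm_lty; rewrite patch_setT.
  have [s s0 Ks] := bounded_set_norm (compact_bounded cK).
  have mK := closed_measurable_rV clK.
  apply: (@le_lt_trans _ _ (\int[mu]_x ((r ^+ 2)%:E * (\1_K x)%:E))%E).
    apply: ge0_le_integral => //.
    - by move=> x _; rewrite lee_fin sqr_ge0.
    - by apply/measurable_EFinP; exact: measurable_funX.
    - by apply: measurable_funeM; apply/measurable_EFinP; exact: measurable_indic.
    - move=> x _; rewrite -EFinM lee_fin indicE; case: (boolP (x \in K)) => [_|].
        rewrite mulr1 -[leLHS]real_normK ?num_real//.
        by apply: lerXn2r; rewrite ?nnegrE// (le_trans _ (fr x)).
      by rewrite notin_setE => /fK ->; rewrite expr0n mulr0.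
  rewrite ge0_integralZl_EFin//; last 2 first.
  + by apply/measurable_EFinP; exact: measurable_indic.
  + exact: sqr_ge0.
  rewrite integral_indic// setIT; apply: lte_mul_pinfty => //; first by rewrite lee_fin sqr_ge0.
  apply: le_lt_trans (lebesgue_rV_cube_lty d s); apply: le_measure; rewrite ?inE//.
  exact: measurable_rV_cube0.
- apply: subclosed_compact cK sub.
  by apply: open_closedC; apply: bigcup_open => O' [].
Qed.

End L2.

Section conservation.
Context (R : realType) (d : nat) (T K : R) (A : 'rV[R]_d -> R -> 'rV[R]_d).
Hypotheses (T0 : 0 <= T) (K0 : 0 < K).
Hypothesis Acont : continuous (fun q : 'rV[R]_d * R => A q.1 (clamp T q.2)).
Hypothesis Alip : forall x y t, t \in `[0, T] -> `|A x t - A y t| <= K * `|x - y|.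
Variable Omega : set 'rV[R]_d.
Local Notation mu := (lebesgue_rV R d).

Let zT : 0 \in `[0, T]. Proof. by rewrite in_itv/= lexx. Qed.
Let TT : T \in `[0, T]. Proof. by rewrite in_itv/= T0 lexx. Qed.

Lemma moving_domainE t : t \in `[0, T] ->
  moving_domain A T Omega t = flow A T t T @^-1` Omega.
Proof.
move=> tT; apply/seteqP; split=> [_ [z Oz <-]|x Ox] /=.
  by rewrite (flowK T0 K0 Acont Alip).
by exists (flow A T t T x) => //; exact: (flowK T0 K0 Acont Alip).
Qed.

Lemma test_function_flow (g : 'rV[R]_d -> R) s t x : s \in `[0, T] -> t \in `[0, T] ->
  test_function A T (g \o flow A T T t) x s = g (flow A T s t x).
Proof. by move=> sT tT; rewrite /test_function /= (flow_comp T0 K0 Acont Alip). Qed.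

Lemma solution_integral (U0 Psi : 'rV[R]_d -> R) (U : 'rV[R]_d -> R -> R) t :
  integral_invariant_solution A T Omega U0 U -> H0 Omega Psi -> t \in `[0, T] ->
  measurable (moving_domain A T Omega 0) -> measurable_fun setT U0 ->
  measurable_fun setT (fun x => test_function A T Psi x 0) ->
  (\int[mu]_(x in moving_domain A T Omega t) (U x t * test_function A T Psi x t) =
   \int[mu]_(x in moving_domain A T Omega 0) (U0 x * test_function A T Psi x 0))%R.
Proof.
move=> [[UL2 _] U0E Uder] HPsi tT mO mU0 mPsi.
pose f s : R := \int[mu]_(x in moving_domain A T Omega s) (U x s * test_function A T Psi x s).
have zero_le s : s \in `[0, T] -> `|0 : R| <= 0 * expR (1 * `|s - 0|).
  by move=> _; rewrite normr0 mul0r.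
have := @exp_growth R T 0 1 0 f (fun=> 0) ltr01 zT (Uder _ HPsi) zero_le t tT.
rewrite !mul0r normr_le0 subr_eq0 => /eqP.
rewrite /f => ->; rewrite /Rintegral; congr fine.
have mtest : measurable_fun (moving_domain A T Omega 0) (fun x => test_function A T Psi x 0).
  exact: measurable_funS mPsi.
apply: ae_eq_integral => //.
- by apply/measurable_EFinP; apply: measurable_funM => //; case: (UL2 _ zT).
- by apply/measurable_EFinP; apply: measurable_funM => //; exact: measurable_funS mU0.
- by apply: filterS U0E => x /= H Ox; rewrite H.
Qed.

End conservation.

Theorem theorem5p2 (R : realType) (d : nat) (hd : (0 < d)%N)
    (T : R) (hT : 0 < T)
    (Omega : set 'rV[R]_d) (hOmega_open : open Omega)
    (hOmega_bounded : bounded_set Omega)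
    (A : 'rV[R]_d -> R -> 'rV[R]_d) (hA : C1_field T A)
    (L_A : R) (hL_A : 0 < L_A)
    (hgradA : forall (x : 'rV[R]_d) (t : R), t \in `[0, T] ->
      opnorm (spatial_jacobian A x t) <= L_A)
    (M_A : R) (hM_A : 0 < M_A)
    (hdivA : forall (x : 'rV[R]_d) (t : R), t \in `[0, T] ->
      `|divergence A x t| <= M_A)
    (U0 V0 : 'rV[R]_d -> R)
    (hU0 : H0 (moving_domain A T Omega 0) U0)
    (hV0 : H0 (moving_domain A T Omega 0) V0)
    (hU0V0 : ~ (U0 = V0 %[ae lebesgue_rV R d]))
    (U V : 'rV[R]_d -> R -> R)
    (hU : integral_invariant_solution A T Omega U0 U)
    (hV : integral_invariant_solution A T Omega V0 V) :
  forall t : R, t \in `[0, T] ->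
    (L2norm (moving_domain A T Omega t) (fun x => (U x t - V x t)%R) <=
     (expR (M_A * T / 2))%:E *
       L2norm (moving_domain A T Omega 0) (fun x => (U0 x - V0 x)%R))%E.
Proof.
move=> t tT; have T0 := ltW hT; have K0 := C1_lipschitz_gt0 hd hL_A.
have Ac := C1_continuous T0 hA; have Al := C1_lipschitz T0 hA hL_A hgradA.
have zT : 0 \in `[0, T] by rewrite in_itv/= lexx.
have TT : T \in `[0, T] by rewrite in_itv/= T0 lexx.
have cD a b : a \in `[0, T] -> b \in `[0, T] -> continuous (flow A T a b).
  exact: (flow_continuous hd T0 hA hL_A hgradA).
have mD a b (aT : a \in `[0, T]) (bT : b \in `[0, T]) :=
  continuous_measurable_rV_rV (cD a b aT bT).
have mO s : s \in `[0, T] -> measurable (moving_domain A T Omega s).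
  move=> sT; rewrite (moving_domainE T0 K0 Ac Al)// -[X in measurable X]setTI.
  by apply: mD => //; exact: open_measurable_rV.
have [[UL2 _] _ _] := hU; have [[VL2 _] _ _] := hV.
have [U0L2 _ _] := hU0; have [V0L2 _ _] := hV0.
have [UtL2 VtL2] := (UL2 t tT, VL2 t tT).
have U0G := in_L2_setT_sub (mO _ zT) U0L2; have V0G := in_L2_setT_sub (mO _ zT) V0L2.
apply: (@le_trans _ _ ((expR (M_A * t / 2))%:E *
    L2norm (moving_domain A T Omega 0) (fun x => (U0 x - V0 x)%R))%E); last first.
  apply: lee_wpmul2r; first by rewrite L2normE poweR_ge0.
  rewrite lee_fin ler_expR ler_wpM2r// ler_wpM2l//; first exact: ltW.
  by move: tT; rewrite in_itv/= => /andP[].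
apply: le_L2norm.
pose E n := flow A T t T @^-1` inner_core Omega n.
have mE n : measurable (E n).
  rewrite /E -[X in measurable X]setTI; apply: mD => //.
  exact: closed_measurable_rV (@inner_core_closed _ _ _ _).
have Svol := flow_volume hd T0 hA hL_A (ltW hM_A) hgradA hdivA tT.
have mw : measurable_fun setT ((fun x => U x t - V x t) \_ (moving_domain A T Omega t)).
  apply/(measurable_restrictT _ (mO _ tT)).
  by apply: measurable_funB; [case: UtL2|case: VtL2].
have [r r0 Or] := bounded_set_norm hOmega_bounded.
have Enorm : exists2 s, 0 <= s & forall n x, E n x -> `|x| <= s.
  have [C [C0 HC]] := flow_bounded T0 K0 Ac Al.
  exists (C * (1 + r)) => [|n x /inner_core_sub/Or xr]; first by rewrite mulr_ge0// addr_ge0.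
  rewrite -(flowK T0 K0 Ac Al x tT TT); apply: le_trans (HC _ _ _ TT tT) _.
  by rewrite ler_wpM2l// lerD2l.
have E_fin n : (lebesgue_rV R d (E n) < +oo)%E.
  have [s s0 Es] := Enorm.
  apply: le_lt_trans (lebesgue_rV_cube_lty d s); apply: le_measure; rewrite ?inE//; last exact: Es.
  exact: measurable_rV_cube0.
apply: (duality_bound (S := flow A T 0 t) (E := E)) => //.
- exact: mD.
- exact: expR_gt0.
- apply/(measurable_restrictT _ (mO _ zT)).
  by apply: measurable_funB; [case: U0G|case: V0G].
- move=> m n /(@inner_core_nondecreasing _ _ Omega)/subsetPset mn.
  by apply/subsetPset => x; exact: mn.
- move=> x; rewrite patchE; case: ifPn; last by rewrite eqxx.
  rewrite inE (moving_domainE T0 K0 Ac Al)// => Ox _.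
  by have [n nN] := inner_core_bigcup hOmega_open Ox; exists n.
move=> n; set w := (_ \_ _); pose g := truncation w E n.
have mg : measurable_fun setT g by exact: measurable_truncation.
have g2 : (\int[lebesgue_rV R d]_x (g x ^+ 2)%:E < +oo)%E by exact: truncation_square_fin.
have gS2 : (\int[lebesgue_rV R d]_x (g (flow A T 0 t x) ^+ 2)%:E < +oo)%E.
  apply: le_lt_trans (Svol (fun x => (g x ^+ 2)%:E) _ _) _.
  - by move=> x; rewrite lee_fin sqr_ge0.
  - by apply/measurable_EFinP; exact: measurable_funX.
  - by apply: lte_mul_pinfty => //; rewrite lee_fin expR_ge0.
have mgS : measurable_fun setT (g \o flow A T 0 t) by exact: measurableT_comp mg (mD _ _ zT tT).
have HPsi : H0 Omega (g \o flow A T T t).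
  apply: (@H0_compact R d Omega (inner_core Omega n) _ n%:R).
  - apply: bounded_closed_compact (@inner_core_closed _ _ _ _).
    exists r; split; first exact: num_real.
    by move=> s rs x /inner_core_sub/Or xr; exact: le_trans xr (ltW rs).
  - exact: inner_core_sub.
  - exact: measurableT_comp mg (mD _ _ TT tT).
  - by move=> x; exact: truncation_norm.
  - move=> x nx; apply: truncation_out => Ex; apply: nx; move: Ex; rewrite /E /=.
    by rewrite (flowK T0 K0 Ac Al).
rewrite (Rintegral_restrict_sub (mO _ tT) UtL2 VtL2 mg g2).
rewrite (Rintegral_restrict_sub (mO _ zT) U0G V0G mgS gS2).
have testE s x : s \in `[0, T] -> test_function A T (g \o flow A T T t) x s = g (flow A T s t x).
  by move=> sT; exact: (test_function_flow T0 K0 Ac Al).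
have mtest : measurable_fun setT (fun x => test_function A T (g \o flow A T T t) x 0).
  by under eq_fun do rewrite testE//.
have conserved W W0 : integral_invariant_solution A T Omega W0 W -> in_L2 setT W0 ->
    \int[lebesgue_rV R d]_(x in moving_domain A T Omega t) (W x t * g x) =
    \int[lebesgue_rV R d]_(x in moving_domain A T Omega 0) (W0 x * g (flow A T 0 t x)).
  move=> HW [mW0 _].
  have := solution_integral T0 HW HPsi tT (mO _ zT) mW0 mtest.
  under eq_Rintegral do rewrite testE// (flow_id T0 K0 Ac Al)//.
  by under [RHS]eq_Rintegral do rewrite testE//.
by rewrite (conserved U U0)// (conserved V V0).
Qed.
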